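(* Let $T$ be a quaternionic torus. The group $Aut(T)$ of biregular automorphisms of $T$ is isomorphic to the group $2\mathbb T$ if and only if, for some $I,J\in\mathbb S$ with $J\perp I$, setting $K=IJ$ and $\omega=\frac{-1+I+J+K}{2}$, the point $(-\omega,-I,I\omega)$ is (a representative of) the modulus of $T$.
   Context: $\mathbb H\cong\mathbb R^4$ is the skew field of quaternions with its Euclidean scalar product $\langle\cdot,\cdot\rangle$ and norm $|\cdot|$; $\mathbb S=\{q\in\mathbb H: q^2=-1\}$, $\mathbb S^3=\{q\in\mathbb H:|q|=1\}$. A function $f:\Omega\to\mathbb H$ on a domain $\Omega\subseteq\mathbb H$ is (slice) regular if for every $I\in\mathbb S$ its restriction $f_I$ to $\Omega\cap(\mathbb R+I\mathbb R)$ has continuous derivatives and $\frac12\left(\frac{\partial}{\partial x}+I\frac{\partial}{\partial y}\right)f_I(x+Iy)=0$. A rank-4 lattice in $\mathbb H$ is the additive subgroup generated by four $\mathbb R$-linearly independent elements. A quaternionic torus is a quotient $T=\mathbb H/L$, $L$ a rank-4 lattice, with the atlas of local inverses of the projection $\pi:\mathbb H\to\mathbb H/L$ on small connected open sets. A map between two quaternionic tori is regular if its expressions in these charts are slice regular; a biregular diffeomorphism is a bijective regular map with regular inverse. Two tori are equivalent if there is a biregular diffeomorphism of one onto the other. For $T=\mathbb H/L$, $Aut(T)$ is the group (under composition) of maps $F(q)=qa$ with $a\in\mathbb S^3$ and $F(L)=L$. The Gram matrix of an (ordered) basis $\{v_1,v_2,v_3,v_4\}$ of a rank-4 lattice is $(\langle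 v_i,v_j\rangle)_{i,j}$. A Gram matrix $R=(r_{i,j})$ is reduced (in the sense of Minkowski–Siegel) if and only if: B1) $r_{k,k+1}\ge 0$ for $k=1,2,3$; B2) for each $k=1,2,3,4$, $n R\,{}^tn\ge r_{k,k}$ for every $n=(n_1,n_2,n_3,n_4)\in\mathbb Z^4$ such that $\gcd(n_k,\dots,n_4)=1$. A special basis is a basis whose Gram matrix is reduced and whose first element is $1$. $\mathcal M=\{(v_2,v_3,v_4)\in\mathbb H^3:\{1,v_2,v_3,v_4\}\text{ is a special basis}\}$. A triple $(v_2,v_3,v_4)$ is (a representative of) the modulus of $T$ if $(v_2,v_3,v_4)\in\mathcal M$ and $T$ is equivalent to $\mathbb H/(\mathbb Z+\mathbb Zv_2+\mathbb Zv_3+\mathbb Zv_4)$. $2\mathbb T$ is the binary tetrahedral group of order $24$, i.e. the subgroup of $\mathbb S^3$ generated by $I$ and $\frac{-1+I+J+IJ}{2}$, where $I,J\in\mathbb S$ are orthogonal. *)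

(* Defs.v *)
From HB Require Import structures.
From mathcomp Require Import all_boot all_order all_algebra ring.
From mathcomp Require Import all_classical all_reals all_analysis.
Set Implicit Arguments.
Unset Strict Implicit.
Unset Printing Implicit Defensive.
Import Order.TTheory GRing.Theory Num.Theory numFieldNormedType.Exports.
Local Open Scope classical_set_scope.
Local Open Scope ring_scope.
Local Open Scope quotient_scope.

(* Quaternions a + b i + c j + d k, as the row vector (a, b, c, d).  The
   topology is inherited from 'rV[R]_4 (whose norm `|_| is the sup norm); the
   Euclidean norm is [qnorm] below. *)
Definition quat (R : realType) := 'rV[R]_4.

HB.instance Definition _ (R : realType) := NormedModule.on (quat R).
HB.instance Definition _ (R : realType) := Vector.on (quat R).

Section Quaternions.
Variable R : realType.
Implicit Types p q : quat R.

Definition mkquat (a b c d : R) : quat R := \row_i tnth [tuple a; b; c; d] i.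

Definition qmul p q : quat R :=
  mkquat
    (p 0 0 * q 0 0 - p 0 1 * q 0 1 - p 0 2 * q 0 2 - p 0 3 * q 0 3)
    (p 0 0 * q 0 1 + p 0 1 * q 0 0 + p 0 2 * q 0 3 - p 0 3 * q 0 2)
    (p 0 0 * q 0 2 - p 0 1 * q 0 3 + p 0 2 * q 0 0 + p 0 3 * q 0 1)
    (p 0 0 * q 0 3 + p 0 1 * q 0 2 - p 0 2 * q 0 1 + p 0 3 * q 0 0).

Definition qone : quat R := mkquat 1 0 0 0.

Definition qconj q : quat R :=
  mkquat (q 0 0) (- q 0 1) (- q 0 2) (- q 0 3).

Definition qdot p q : R := \sum_i p 0 i * q 0 i.

Definition qnorm q : R := Num.sqrt (qdot q q).

Definition qinv q : quat R := (qdot q q)^-1 *: qconj q.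

Lemma quatP p q : p 0 0 = q 0 0 -> p 0 1 = q 0 1 -> p 0 2 = q 0 2 ->
  p 0 3 = q 0 3 -> p = q.
Proof.
move=> e0 e1 e2 e3; apply/rowP => -[[|[|[|[|//]]]] i4].
- by rewrite (_ : Ordinal i4 = 0) //; apply/val_inj.
- by rewrite (_ : Ordinal i4 = 1) //; apply/val_inj.
- by rewrite (_ : Ordinal i4 = 2) //; apply/val_inj.
- by rewrite (_ : Ordinal i4 = 3) //; apply/val_inj.
Qed.

Lemma mkquatE a b c d :
  (mkquat a b c d 0 0 = a) * (mkquat a b c d 0 1 = b) *
  (mkquat a b c d 0 2 = c) * (mkquat a b c d 0 3 = d).
Proof. by rewrite /mkquat !mxE !(tnth_nth 0). Qed.

Lemma quatD p q i : (p + q) 0 i = p 0 i + q 0 i.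
Proof. exact: mxE. Qed.

Lemma quatZ a q i : (a *: q) 0 i = a * q 0 i.
Proof. exact: mxE. Qed.

Lemma qdotE p q : qdot p q =
  p 0 0 * q 0 0 + p 0 1 * q 0 1 + p 0 2 * q 0 2 + p 0 3 * q 0 3.
Proof.
rewrite /qdot !big_ord_recl big_ord0 addr0 !addrA.
by congr (_ + _ + _ + _); congr (p _ _ * q _ _); apply/val_inj.
Qed.

Lemma qmulA : associative qmul.
Proof. by move=> p q r; apply: quatP; rewrite /qmul !mkquatE; ring. Qed.

Lemma qmul1q : left_id qone qmul.
Proof. by move=> p; apply: quatP; rewrite /qmul !mkquatE; ring. Qed.

Lemma qmulq1 : right_id qone qmul.
Proof. by move=> p; apply: quatP; rewrite /qmul !mkquatE; ring. Qed.

Lemma qmulDl : left_distributive qmul +%R.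
Proof. by move=> p q r; apply: quatP; rewrite !quatD /qmul !mkquatE !quatD; ring. Qed.

Lemma qmulDr : right_distributive qmul +%R.
Proof. by move=> p q r; apply: quatP; rewrite !quatD /qmul !mkquatE !quatD; ring. Qed.

Lemma qone_neq0 : qone != 0.
Proof.
apply/eqP => /rowP/(_ 0) /eqP.
by rewrite /qone mkquatE mxE oner_eq0.
Qed.

HB.instance Definition _ := GRing.Zmodule_isNzRing.Build (quat R)
  qmulA qmul1q qmulq1 qmulDl qmulDr qone_neq0.

Lemma qdot_eq0 q : (qdot q q == 0) = (q == 0).
Proof.
apply/eqP/eqP => [|->]; last first.
  by rewrite /qdot big1 // => i _; rewrite mxE mul0r.
move=> /eqP; rewrite psumr_eq0; last by move=> i _; rewrite -expr2 sqr_ge0.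
move=> /allP q0; apply/rowP => i.
have := q0 i (mem_index_enum _).
by rewrite mxE /= mulf_eq0 orbb => /eqP.
Qed.

Lemma qmulVq : {in [pred q | q != 0], left_inverse qone qinv qmul}.
Proof.
move=> q; rewrite inE -qdot_eq0 qdotE => q0.
apply: quatP; rewrite /qmul /qone !mkquatE
  /qinv !quatZ !mkquatE qdotE; [by field|by ring..].
Qed.

Lemma qmulqV : {in [pred q | q != 0], right_inverse qone qinv qmul}.
Proof.
move=> q; rewrite inE -qdot_eq0 qdotE => q0.
apply: quatP; rewrite /qmul /qone !mkquatE
  /qinv !quatZ !mkquatE qdotE; [by field|by ring..].
Qed.

Lemma quat_unitP p q : q * p = 1 /\ p * q = 1 -> p \in [pred q | q != 0].
Proof.
case=> + _; rewrite inE; apply: contraPneq => ->; rewrite mulr0 => /esym/eqP.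
by rewrite oner_eq0.
Qed.

Lemma qinv_out : {in [predC [pred q | q != 0]], qinv =1 id}.
Proof.
move=> q; rewrite !inE negbK => /eqP ->.
by apply: quatP; rewrite /qinv !quatZ !mkquatE !mxE ?oppr0 mulr0.
Qed.

HB.instance Definition _ := GRing.NzRing_hasMulInverse.Build (quat R)
  qmulVq qmulqV quat_unitP qinv_out.

Definition imag_units : set (quat R) := [set q | q ^+ 2 = -1].

Definition S3 : set (quat R) := [set q | qnorm q = 1].

End Quaternions.

Arguments imag_units {R}.
Arguments S3 {R}.

Section SliceRegular.
Variable R : realType.

(* The point x + I y of the plane R + I R, for z = (x, y). *)
Definition slice_point (I : quat R) (z : R * R) : quat R :=
  z.1 *: (1 : quat R) + z.2 *: I.

(* Allowing a disconnected open set is harmless, since the condition is local. *)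
Definition slice_regular (Omega : set (quat R)) (f : quat R -> quat R) : Prop :=
  open Omega /\
  forall I, imag_units I ->
    let fI := f \o slice_point I in
    let OmegaI := slice_point I @^-1` Omega in
    [/\ forall z, OmegaI z -> derivable fI z (1, 0) /\ derivable fI z (0, 1),
        {within OmegaI, continuous (fun z => 'D_(1, 0) fI z)},
        {within OmegaI, continuous (fun z => 'D_(0, 1) fI z)} &
        forall z, OmegaI z ->
          2^-1 *: ('D_(1, 0) fI z + I * 'D_(0, 1) fI z) = 0].

End SliceRegular.

Section Tori.
Variable R : realType.

Definition Zspan (v : 4.-tuple (quat R)) : set (quat R) :=
  [set q | exists n : 'I_4 -> int, q = \sum_i tnth v i *~ n i].

Record lattice := Lattice {
  lattice_set :> set (quat R);
  latticeP : exists2 v : 4.-tuple (quat R), free v & lattice_set = Zspan v }.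

Definition lattice_rel (L : lattice) : rel (quat R) :=
  fun p q => `[< lattice_set L (p - q) >].

Lemma lattice_rel_refl L : reflexive (lattice_rel L).
Proof.
move=> p; apply/asboolP; have [v _ ->] := latticeP L; exists (fun=> 0).
by rewrite subrr big1.
Qed.

Lemma lattice_rel_sym L : symmetric (lattice_rel L).
Proof.
suff sub p q : lattice_rel L p q -> lattice_rel L q p.
  by move=> p q; apply/idP/idP; exact: sub.
have [v _ LE] := latticeP L; rewrite /lattice_rel LE => /asboolP[n e].
apply/asboolP; exists (fun i => - n i); rewrite -opprB e -sumrN.
by apply: eq_bigr => i _; rewrite mulrNz.
Qed.

Lemma lattice_rel_trans L : transitive (lattice_rel L).
Proof.
have [v _ LE] := latticeP L; rewrite /lattice_rel LE.
move=> q p r /asboolP[m e] /asboolP[n f].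
apply/asboolP; exists (fun i => m i + n i).
rewrite -[p](subrK q) -addrA e f -big_split /=.
by apply: eq_bigr => i _; rewrite mulrzDr.
Qed.

Definition lattice_equiv L := EquivRel (lattice_rel L)
  (@lattice_rel_refl L) (@lattice_rel_sym L) (@lattice_rel_trans L).

Definition torus (L : lattice) := {eq_quot lattice_equiv L}.

Definition proj (L : lattice) (q : quat R) : torus L := \pi_(torus L) q.

Definition chart_dom (L : lattice) (U : set (quat R)) : Prop :=
  [/\ open U, connected U & {in U &, injective (proj L)}].

(* The chart attached to U, i.e. the inverse of [proj L] restricted to U; the
   value 0 outside [proj L @` U] is junk. *)
Definition chart (L : lattice) (U : set (quat R)) : torus L -> quat R :=
  'pinv_(fun=> 0) U (proj L).

(* The domain of the expression of F is required to be open by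
   [slice_regular]; over all U and V, this is the continuity of F for the
   quotient topologies. *)
Definition regular_map (L1 L2 : lattice) (F : torus L1 -> torus L2) : Prop :=
  forall U V, chart_dom L1 U -> chart_dom L2 V ->
    slice_regular (U `&` [set q | (proj L2 @` V) (F (proj L1 q))])
      (fun q => chart V (F (proj L1 q))).

Definition biregular (L1 L2 : lattice) (F : torus L1 -> torus L2) : Prop :=
  regular_map F /\ exists G, [/\ cancel F G, cancel G F & regular_map G].

Definition equivalent_tori (L1 L2 : lattice) : Prop :=
  exists F : torus L1 -> torus L2, biregular F.

(* The automorphisms are given by their lifts to the quaternions; distinct lifts
   induce distinct maps of the torus, as L is discrete. *)
Definition Aut (L : lattice) : set (quat R -> quat R) :=
  [set F | exists2 a, S3 a & F = (fun q => q * a) /\ F @` L = L].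

End Tori.

Section Moduli.
Variable R : realType.

Definition gram (v : 4.-tuple (quat R)) : 'M[R]_4 :=
  \matrix_(i, j) qdot (tnth v i) (tnth v j).

(* Indices are shifted by one: k : 'I_4 stands for k + 1. *)
Definition reduced (G : 'M[R]_4) : Prop :=
  (forall i j : 'I_4, j = i.+1 :> nat -> 0 <= G i j) /\
  (forall (k : 'I_4) (n : 'rV[int]_4),
     \big[gcdz/0]_(i < 4 | (k <= i)%N) n 0 i = 1 ->
     let nR := map_mx intr n : 'rV[R]_4 in
     G k k <= (nR *m G *m nR^T) 0 0).

Definition special_basis (v : 4.-tuple (quat R)) : Prop :=
  [/\ free v, reduced (gram v) & tnth v 0 = 1].

Definition moduli_space : set (quat R * quat R * quat R) :=
  [set m | special_basis [tuple 1; m.1.1; m.1.2; m.2]].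

Definition is_modulus (L : lattice R) (m : quat R * quat R * quat R) : Prop :=
  moduli_space m /\
  exists2 L' : lattice R,
    L' = Zspan [tuple 1; m.1.1; m.1.2; m.2] :> set (quat R) &
    equivalent_tori L L'.

End Moduli.

Section Groups.

Definition group_isomorphic (A B : Type) (G : set A) (opA : A -> A -> A)
    (H : set B) (opB : B -> B -> B) : Prop :=
  exists phi : A -> B, set_bij G H phi /\
    {in G &, {morph phi : x y / opA x y >-> opB x y}}.

Variable R : realType.

Definition subgroup_S3 (G : set (quat R)) : Prop :=
  [/\ G `<=` S3, G 1, forall p q, G p -> G q -> G (p * q) &
      forall q, G q -> G q^-1].

Definition omega (I J : quat R) : quat R := 2^-1 *: (-1 + I + J + I * J).

Definition binary_tetrahedral (I J : quat R) : set (quat R) :=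
  smallest subgroup_S3 [set I; omega I J].

End Groups.

(* Main.v *)
Require Import Defs.
From mathcomp Require Import all_boot all_order all_algebra ring lra zify.
From mathcomp Require Import all_classical all_reals all_analysis.
Import Order.TTheory GRing.Theory Num.Theory numFieldNormedType.Exports.
Local Open Scope classical_set_scope.
Local Open Scope ring_scope.
Set Implicit Arguments.
Unset Strict Implicit.
Unset Printing Implicit Defensive.

(** The idea is that two tori H/L and H/L' are equivalent exactly when L' = L a for
    a nonzero quaternion a, and that a lattice on which a binary tetrahedral
    group acts by right multiplication is a rank one module over the Hurwitz
    order.

    That L' = L a yields equivalent tori is a computation in charts
    (mulr_equivalent). Conversely, let F : H/L -> H/L' be regular
    and injective. By compactness F o pi has, on all balls of one fixed radius,
    lifts f of small oscillation (local_lifts). For a small real h the step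
    f(q + h) - f(q) does not depend on the choice of the small lift, so it is a
    bounded function on all of H, and it is holomorphic on each slice. By
    Liouville's theorem it is constant on each slice, and the constant is the
    same on all slices because they share the real axis (small_step_const). Thus
    every local lift has the same real derivative a, hence is q |-> q a + const
    along each slice, and summing along rays gives F(pi q) = pi'(q a + b)
    (regular_map_affine); injectivity then says that L' = L a
    (regular_injective_mulr). Liouville's theorem is proved with real integrals
    over circles (liouville_partial_eq0).

    The rest is algebra. For orthogonal imaginary units I, J the lattice spanned
    by 1, -omega, -I, I omega is the Hurwitz order of the frame I, J, IJ
    (Zspan_hurwitz); the squared length of its vectors is an integer, so this
    basis is special, and the Hurwitz integers of norm one form the binary
    tetrahedral group (binary_tetrahedralE). If H/L has this lattice as modulus, then L is a
    right translate of the Hurwitz order and Aut(H/L) is conjugate to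
    its unit group, up to the order reversal caused by acting on the right
    (modulus_tetrahedral). If Aut(H/L) is isomorphic to the binary
    tetrahedral group, then L is stable under right multiplication by some a of
    order 4 and b of order 3 such that a b has order 3. These orders force
    b = omega(a, J) for some J (omega_recover), so L is a module over the
    Hurwitz order of the frame a, J, a J. As that order is norm-Euclidean,
    L = l O for some l (lattice_hurwitz_principal), and
    L l^-1 = l O l^-1 is the Hurwitz order of the conjugate frame
    (tetrahedral_modulus). *)

(** * Arithmetic of quaternions *)

Section Arithmetic.
Variable R : realType.
Implicit Types p q w : quat R.

Lemma quatME p q :
  ((p * q) 0 0 =
    p 0 0 * q 0 0 - p 0 1 * q 0 1 - p 0 2 * q 0 2 - p 0 3 * q 0 3) *
  ((p * q) 0 1 =
    p 0 0 * q 0 1 + p 0 1 * q 0 0 + p 0 2 * q 0 3 - p 0 3 * q 0 2) *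
  ((p * q) 0 2 =
    p 0 0 * q 0 2 - p 0 1 * q 0 3 + p 0 2 * q 0 0 + p 0 3 * q 0 1) *
  ((p * q) 0 3 =
    p 0 0 * q 0 3 + p 0 1 * q 0 2 - p 0 2 * q 0 1 + p 0 3 * q 0 0).
Proof. by rewrite /GRing.mul /= /qmul !mkquatE. Qed.

Lemma quat1E : ((1 : quat R) 0 0 = 1) * ((1 : quat R) 0 1 = 0) *
  ((1 : quat R) 0 2 = 0) * ((1 : quat R) 0 3 = 0).
Proof. by rewrite /GRing.one /= /qone !mkquatE. Qed.

Lemma quatN q i : (- q) 0 i = - q 0 i.
Proof. exact: mxE. Qed.

Lemma quat0 i : (0 : quat R) 0 i = 0.
Proof. exact: mxE. Qed.

Definition quatE := (quatME, quat1E, quatN, quatD, quatZ, quat0, @mkquatE R).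

Lemma scaleqAl (a : R) p q : a *: (p * q) = (a *: p) * q.
Proof. by apply: quatP; rewrite !quatE; ring. Qed.

Lemma scaleqAr (a : R) p q : a *: (p * q) = p * (a *: q).
Proof. by apply: quatP; rewrite !quatE; ring. Qed.

Lemma qdot_mul p q : qdot (p * q) (p * q) = qdot p p * qdot q q.
Proof. by rewrite !qdotE !quatE; ring. Qed.

Lemma qdot0l q : qdot 0 q = 0.
Proof. by rewrite qdotE !quat0; ring. Qed.

Lemma qdotBl p q w : qdot (p - q) w = qdot p w - qdot q w.
Proof. by rewrite !qdotE !quatE; ring. Qed.

Lemma qdot_ge0 q : 0 <= qdot q q.
Proof. by rewrite /qdot sumr_ge0 // => i _; rewrite -expr2 sqr_ge0. Qed.

Lemma qdot_gt0 q : (0 < qdot q q) = (q != 0).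
Proof. by rewrite lt_def qdot_eq0 qdot_ge0 andbT. Qed.

Lemma S3P q : S3 q <-> qdot q q = 1.
Proof.
rewrite /S3 /= /qnorm; split => [e|->]; last by rewrite sqrtr1.
by rewrite -(sqr_sqrtr (qdot_ge0 q)) e expr1n.
Qed.

Lemma S3_neq0 q : S3 q -> q != 0.
Proof. by move/S3P => h; rewrite -qdot_eq0 h oner_eq0. Qed.

Lemma qdot1 : qdot (1 : quat R) 1 = 1.
Proof. by rewrite qdotE !quatE; ring. Qed.

Lemma quat_unitE q : (q \is a GRing.unit) = (q != 0).
Proof. by []. Qed.

Lemma qdotV q : qdot q^-1 q^-1 = (qdot q q)^-1.
Proof.
have [->|q0] := eqVneq q 0.
  by rewrite invr0 (_ : qdot 0 0 = 0) ?invr0 //; apply/eqP; rewrite qdot_eq0.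
have n0 : qdot q q != 0 by rewrite qdot_eq0.
by apply: (mulfI n0); rewrite -qdot_mul divrr ?quat_unitE // qdot1 divff.
Qed.

Lemma qmul_eq0 p q : (p * q == 0) = (p == 0) || (q == 0).
Proof. by rewrite -!qdot_eq0 qdot_mul mulf_eq0. Qed.

(** The imaginary part of q^2 is 2 Re(q) Im(q), and its real part is
    Re(q)^2 - |Im(q)|^2; a real q has a nonnegative square. *)
Lemma imag_unitsP q : imag_units q <-> q 0 0 = 0 /\ qdot q q = 1.
Proof.
rewrite /imag_units /= expr2 qdotE; split=> [e|[q0 n1]]; last first.
  by apply: quatP; rewrite !quatE !q0; move: n1; rewrite !q0; lra.
have := congr1 (fun x : quat R => x 0 0) e; have := congr1 (fun x : quat R => x 0 1) e.
have := congr1 (fun x : quat R => x 0 2) e; have := congr1 (fun x : quat R => x 0 3) e.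
rewrite !quatE => e3 e2 e1 e0.
have [q0|q0] := eqVneq (q 0 0) 0; first by split=> //; move: e0; rewrite !q0; lra.
have z x : q 0 0 * x + x * q 0 0 = 0 -> x = 0.
  rewrite [x * _]mulrC -mulr2n => /eqP.
  by rewrite mulrn_eq0 /= mulf_eq0 (negbTE q0) => /eqP.
have q1 : q 0 1 = 0 by apply: z; move: e1; lra.
have q2 : q 0 2 = 0 by apply: z; move: e2; lra.
have q3 : q 0 3 = 0 by apply: z; move: e3; lra.
have := sqr_ge0 (q 0 0).
by move: e0; rewrite q1 q2 q3 expr2; lra.
Qed.

Lemma sqr_quat_eq1 q : q * q = 1 -> q = 1 \/ q = -1.
Proof.
move=> e; have /eqP : (q - 1) * (q + 1) = 0.
  by rewrite mulrDr mulr1 mulrBl mul1r e addrA subrK subrr.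
by rewrite qmul_eq0 subr_eq0 addr_eq0 => /orP[] /eqP ->; [left|right].
Qed.

(** Such a q has norm one and satisfies q^2 + q + 1 = 0, so that q + 1 = - q^-1
    has norm one as well; expanding |q + 1|^2 = |q|^2 gives the real part. *)
Lemma cube_root1 q : q * q * q = 1 -> q <> 1 ->
  q 0 0 = - 2^-1 /\ qdot q q = 1.
Proof.
move=> q3 q1; have /eqP : (q - 1) * (q * q + q + 1) = 0.
  rewrite mulrBl !mulrDr !mulr1 !mul1r mulrA q3.
  by apply: quatP; rewrite !quatE; ring.
rewrite qmul_eq0 subr_eq0 => /orP[/eqP //|/eqP e].
have n1 : qdot q q = 1.
  have := congr1 (fun x => qdot x x) q3; rewrite /= !qdot_mul qdot1.
  set n := qdot q q => n3.
  have /eqP : (n - 1) * (n * n + n + 1) = 0.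
    have -> : (n - 1) * (n * n + n + 1) = n * n * n - 1 by ring.
    by rewrite n3 subrr.
  have := qdot_ge0 q; rewrite -/n => n0.
  rewrite mulf_eq0 subr_eq0 => /orP[/eqP //|/eqP].
  by have := mulr_ge0 n0 n0; lra.
split=> //.
have f : q * q = - q - 1.
  by apply/eqP; rewrite -subr_eq0 -[X in _ == X]e; apply/eqP/quatP; rewrite !quatE; ring.
have g : q + 1 = - q^-1.
  have q0 : q != 0 by apply: S3_neq0; apply/S3P.
  apply: (@mulrI _ q); first by rewrite quat_unitE.
  by rewrite mulrN divrr ?quat_unitE // mulrDr f mulr1 addrAC addNr add0r.
have := congr1 (fun x => qdot x x) g; rewrite /= -[- _^-1]mulN1r qdot_mul qdotV n1.
move: n1; rewrite !qdotE !quatE; lra.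
Qed.

End Arithmetic.

(** * Orthonormal frames *)

Section Frames.
Variable R : realType.
Implicit Types p q : quat R.

Lemma free4_coord (v : 4.-tuple (quat R)) : free v ->
  forall q, q = \sum_i coord v i q *: tnth v i.
Proof.
move=> fv q; have bv : basis_of fullv v.
  by rewrite basisEfree fv subvf dimvf /= size_tuple dim_matrix.
rewrite {1}(coord_basis bv (memvf q)).
by apply: eq_bigr => i _; rewrite (tnth_nth 0).
Qed.

(** For orthogonal imaginary units I, J this is the rotation of the quaternions
    that carries the standard frame i, j, k to I, J, IJ. Being a ring
    automorphism and an isometry, it reduces every computation in the frame
    I, J, IJ to standard coordinates. *)
Definition frame (I J q : quat R) : quat R :=
  q 0 0 *: (1 : quat R) + q 0 1 *: I + q 0 2 *: J + q 0 3 *: (I * J).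

Section Frame.
Variables I J : quat R.
Hypotheses (uI : imag_units I) (uJ : imag_units J) (oIJ : qdot I J = 0).

Let f := frame I J.

Lemma frameD p q : f (p + q) = f p + f q.
Proof.
rewrite /f /frame; set K := I * J; clearbody K.
by apply: quatP; rewrite !quatE; ring.
Qed.

Lemma frameZ a q : f (a *: q) = a *: f q.
Proof.
rewrite /f /frame; set K := I * J; clearbody K.
by apply: quatP; rewrite !quatE; ring.
Qed.

Lemma frameN q : f (- q) = - f q.
Proof. by rewrite -scaleN1r frameZ scaleN1r. Qed.

Lemma frameB p q : f (p - q) = f p - f q.
Proof. by rewrite frameD frameN. Qed.

Lemma frame1 : f 1 = 1.
Proof. by rewrite /f /frame !quatE scale1r !scale0r !addr0. Qed.

Lemma frame_i : f (mkquat 0 1 0 0) = I.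
Proof. by rewrite /f /frame !mkquatE scale1r !scale0r !addr0 add0r. Qed.

Lemma imag_anticomm : J * I = - (I * J).
Proof.
move: uI uJ oIJ => /imag_unitsP[I0 _] /imag_unitsP[J0 _].
rewrite qdotE I0 J0 => o.
by apply: quatP; rewrite !quatE I0 J0; move: o; lra.
Qed.

Lemma frameM p q : f (p * q) = f p * f q.
Proof.
have II : I * I = -1 by rewrite -expr2.
have JJ : J * J = -1 by rewrite -expr2.
have JI := imag_anticomm.
rewrite /f /frame; set K := I * J.
have IK : I * K = - J by rewrite mulrA II mulN1r.
have KJ : K * J = - I by rewrite -mulrA JJ mulrN1.
have KI : K * I = J by rewrite -mulrA JI mulrN mulrA II mulN1r opprK.
have JK : J * K = I by rewrite mulrA JI mulNr -mulrA JJ mulrN1 opprK.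
have KK : K * K = -1 by rewrite {2}/K mulrA KI JJ.
rewrite !(mulrDl, mulrDr) -!(scaleqAl, scaleqAr) !mulr1 !mul1r.
rewrite II JJ JI IK KJ KI JK KK -/K; move: K {IK KJ KI JK KK} => K.
by apply: quatP; rewrite !quatE; ring.
Qed.

Lemma qdot_frame q : qdot (f q) (f q) = qdot q q.
Proof.
move: (uI) (uJ) => /imag_unitsP[I0 nI] /imag_unitsP[J0 nJ].
have nK : qdot (I * J) (I * J) = 1 by rewrite qdot_mul nI nJ mul1r.
have IK : qdot I (I * J) = 0.
  have -> : qdot I (I * J) = qdot I I * J 0 0 by rewrite !qdotE !quatE; ring.
  by rewrite J0 mulr0.
have JK : qdot J (I * J) = 0.
  have -> : qdot J (I * J) = I 0 0 * qdot J J by rewrite !qdotE !quatE; ring.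
  by rewrite I0 mul0r.
have K0 : (I * J) 0 0 = 0.
  by rewrite -[RHS]oppr0 -[in RHS]oIJ qdotE !quatE I0; ring.
rewrite /f /frame; move: (I * J) nK IK JK K0 => K nK IK JK K0.
transitivity (q 0 0 ^+ 2 + q 0 1 ^+ 2 * qdot I I + q 0 2 ^+ 2 * qdot J J +
  q 0 3 ^+ 2 * qdot K K + 2 * q 0 0 * (q 0 1 * I 0 0 + q 0 2 * J 0 0 +
  q 0 3 * K 0 0) + 2 * q 0 1 * (q 0 2 * qdot I J + q 0 3 * qdot I K) +
  2 * q 0 2 * q 0 3 * qdot J K).
  by rewrite !qdotE !quatE; ring.
by rewrite nI nJ nK IK JK oIJ I0 J0 K0 qdotE; ring.
Qed.

Lemma frame_eq0 q : (f q == 0) = (q == 0).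
Proof. by rewrite -!qdot_eq0 qdot_frame. Qed.

Lemma frame_inj : injective f.
Proof. by move=> p q /eqP; rewrite -subr_eq0 -frameB frame_eq0 subr_eq0 => /eqP. Qed.

Lemma frameV q : f q^-1 = (f q)^-1.
Proof.
have [->|q0] := eqVneq q 0.
  by rewrite invr0 (_ : f 0 = 0) ?invr0 //; apply/eqP; rewrite frame_eq0.
have fq : f q \is a GRing.unit by rewrite quat_unitE frame_eq0.
by apply: (mulrI fq); rewrite -frameM !divrr ?frame1 // quat_unitE.
Qed.

Lemma frame_sum (n : nat) (c : 'I_n -> R) (v : 'I_n -> quat R) :
  f (\sum_i c i *: v i) = \sum_i c i *: f (v i).
Proof.
elim: n c v => [|n ih] c v; last by rewrite !big_ord_recl frameD frameZ ih.
by rewrite !big_ord0; apply/eqP; rewrite frame_eq0.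
Qed.

Lemma frame_surj q : exists p, f p = q.
Proof.
pose e (i : 'I_4) : quat R := delta_mx 0 i.
have fr : free [tuple f (e i) | i < 4].
  apply/freeP => k; rewrite (eq_bigr (fun i => k i *: f (e i))); last first.
    by move=> i _; rewrite -tnth_nth tnth_mktuple.
  rewrite -frame_sum => /eqP; rewrite frame_eq0 => /eqP /rowP h i.
  have := h i; rewrite summxE mxE (bigD1 i) //= big1 ?addr0.
    by rewrite !mxE !eqxx mulr1.
  by move=> j ji; rewrite !mxE eqxx eq_sym (negbTE ji) mulr0.
exists (\sum_i coord [tuple f (e i) | i < 4] i q *: e i).
rewrite frame_sum [RHS](free4_coord fr).
by apply: eq_bigr => i _; rewrite tnth_mktuple.
Qed.

End Frame.
End Frames.

(** * The Hurwitz order and its units *)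

Section Hurwitz.
Variable R : realType.
Implicit Types p q : quat R.

(** The Hurwitz order of the standard frame: the parity of m decides whether
    the coordinates are all in Z or all in Z + 1/2, which avoids a case
    distinction in sums and products. *)
Definition hurwitz : set (quat R) :=
  [set q | exists a b c d m : int,
    q = mkquat (a%:~R + m%:~R / 2) (b%:~R + m%:~R / 2)
               (c%:~R + m%:~R / 2) (d%:~R + m%:~R / 2)].

Definition hurwitz_unit : set (quat R) :=
  [set q | hurwitz q /\ qdot q q = 1].

Definition qi : quat R := mkquat 0 1 0 0.
Definition qj : quat R := mkquat 0 0 1 0.
Definition qk : quat R := mkquat 0 0 0 1.
Definition qw : quat R := mkquat (- 2^-1) 2^-1 2^-1 2^-1.

Lemma hurwitz1 : hurwitz 1.
Proof. by exists 1, 0, 0, 0, 0; apply: quatP; rewrite !quatE; ring. Qed.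

Lemma hurwitz_i : hurwitz qi.
Proof. by exists 0, 1, 0, 0, 0; apply: quatP; rewrite !quatE; ring. Qed.

Lemma hurwitz_w : hurwitz qw.
Proof. by exists (-1), 0, 0, 0, 1; apply: quatP; rewrite !quatE; field. Qed.

Lemma hurwitzM p q : hurwitz p -> hurwitz q -> hurwitz (p * q).
Proof.
move=> [a0 [a1 [a2 [a3 [m ->]]]]] [b0 [b1 [b2 [b3 [n ->]]]]].
(* Multiply out with 2 a_i + m and 2 b_i + n; the sum of all cross terms has the
   parity of each of the four partial sums, so it can serve as the new m. *)
exists (a0 * b0 - a1 * b1 - a2 * b2 - a3 * b3
         - n * (a1 + a2 + a3) - m * (b1 + b2 + b3) - m * n),
  (a0 * b1 + a1 * b0 + a2 * b3 - a3 * b2 - n * a3 - m * b2),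
  (a0 * b2 - a1 * b3 + a2 * b0 + a3 * b1 - n * a1 - m * b3),
  (a0 * b3 + a1 * b2 - a2 * b1 + a3 * b0 - n * a2 - m * b1),
  (n * (a0 + a1 + a2 + a3) + m * (b0 + b1 + b2 + b3) + m * n).
by apply: quatP; rewrite !quatE; field.
Qed.

(** Round the coordinates to the nearest integers, or to the nearest elements of
    Z + 1/2. If e_i <= 1/2 are the distances to the former, the distances to
    the latter are 1/2 - e_i, and the two sums of squares cannot both
    exceed 1/2. *)
Lemma hurwitz_round q : exists2 h, hurwitz h & qdot (q - h) (q - h) <= 2^-1.
Proof.
have rnd (x : R) : exists2 a : int, `|x - a%:~R| <= 2^-1 &
    exists b : int, `|x - (b%:~R + 1 / 2)| = 2^-1 - `|x - a%:~R|.
  pose a := Num.floor (x + 2^-1).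
  have ha1 : a%:~R <= x + 2^-1 by apply: floor_le.
  have ha2 : x + 2^-1 < a%:~R + 1.
    by have := floorD1_gt (x + 2^-1); rewrite -/a intrD.
  exists a; first by rewrite ler_norml; lra.
  have [xa|xa] := leP 0 (x - a%:~R).
    by exists a; rewrite (ger0_norm xa) ler0_norm; lra.
  by exists (a - 1); rewrite (ltr0_norm xa) intrB ger0_norm; lra.
have [a0 e0 [b0 f0]] := rnd (q 0 0); have [a1 e1 [b1 f1]] := rnd (q 0 1).
have [a2 e2 [b2 f2]] := rnd (q 0 2); have [a3 e3 [b3 f3]] := rnd (q 0 3).
have [small|big] := leP (`|q 0 0 - a0%:~R| ^+ 2 + `|q 0 1 - a1%:~R| ^+ 2 +
  `|q 0 2 - a2%:~R| ^+ 2 + `|q 0 3 - a3%:~R| ^+ 2) 2^-1.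
  exists (mkquat a0%:~R a1%:~R a2%:~R a3%:~R).
    by exists a0, a1, a2, a3, 0; apply: quatP; rewrite !quatE; ring.
  by move: small; rewrite qdotE !quatE !real_normK ?num_real // !expr2.
exists (mkquat (b0%:~R + 1 / 2) (b1%:~R + 1 / 2) (b2%:~R + 1 / 2) (b3%:~R + 1 / 2)).
  by exists b0, b1, b2, b3, 1.
rewrite qdotE !quatE -!expr2 -![(_ - _) ^+ 2]real_normK ?num_real // f0 f1 f2 f3.
move: e0 e1 e2 e3 big; set x0 := `|_|; set x1 := `|_|; set x2 := `|_|; set x3 := `|_|.
have g (x : R) : 0 <= x -> x <= 2^-1 -> x ^+ 2 <= x / 2.
  by move=> p0 p1; rewrite expr2 ler_wpM2l.
move=> e0 e1 e2 e3 big.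
have g0 := g x0 (normr_ge0 _) e0; have g1 := g x1 (normr_ge0 _) e1.
have g2 := g x2 (normr_ge0 _) e2; have g3 := g x3 (normr_ge0 _) e3.
have s (x : R) : (2^-1 - x) ^+ 2 = 4^-1 - x + x ^+ 2 by field.
rewrite !s; lra.
Qed.

Lemma hurwitz_unit1 : hurwitz_unit 1.
Proof. by split; [exact: hurwitz1|exact: qdot1]. Qed.

Lemma hurwitz_unitM p q : hurwitz_unit p -> hurwitz_unit q -> hurwitz_unit (p * q).
Proof. by move=> [hp np] [hq nq]; split; [exact: hurwitzM|rewrite qdot_mul np nq mulr1]. Qed.

Lemma hurwitz_unit_i : hurwitz_unit qi.
Proof. by split; [exact: hurwitz_i|rewrite qdotE !quatE; ring]. Qed.

Lemma hurwitz_unit_w : hurwitz_unit qw.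
Proof. by split; [exact: hurwitz_w|rewrite qdotE !quatE; field]. Qed.

Lemma hurwitz_unit_sum_sqr a b c d m :
  hurwitz_unit (mkquat (a%:~R + m%:~R / 2) (b%:~R + m%:~R / 2)
               (c%:~R + m%:~R / 2) (d%:~R + m%:~R / 2)) ->
  (2 * a + m) ^+ 2 + (2 * b + m) ^+ 2 + (2 * c + m) ^+ 2 + (2 * d + m) ^+ 2 = 4.
Proof.
move=> [_]; rewrite qdotE !quatE => e; apply: (@intr_inj R).
have -> : (4 : int)%:~R = 4 * 1 :> R by rewrite mulr1.
by apply: etrans (congr1 ( *%R 4) e); rewrite !(rmorphD, rmorphM, rmorphXn) /=; field.
Qed.

Lemma sqr_int_ge1 (x : int) : x != 0 -> 1 <= x ^+ 2.
Proof. by move=> x0; rewrite -gtz0_ge1 exprn_even_gt0. Qed.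

(** The units with integral coordinates are, up to sign, 1, i, j = w^2 i w and
    k = i j; the other ones are, up to sign, the products of w and w^2 with
    these four. *)
Lemma hurwitz_unit_ind (P : set (quat R)) : P qi -> P qw ->
  (forall p q, P p -> P q -> P (p * q)) -> hurwitz_unit `<=` P.
Proof.
move=> Pi Pw PM.
have PN q : P q -> P (- q).
  move=> Pq; rewrite (_ : - q = qi * qi * q); last first.
    by apply: quatP; rewrite !quatE; ring.
  exact: PM (PM _ _ Pi Pi) Pq.
have P1 : P 1.
  rewrite (_ : 1 = - (qi * qi)); last by apply: quatP; rewrite !quatE; ring.
  by apply/PN/PM.
have Pww : P (qw * qw) by exact: PM.
have Pj : P qj.
  have -> : qj = (qw * qw) * (qi * qw).
    have -> : qw * qw = mkquat (- 2^-1) (- 2^-1) (- 2^-1) (- 2^-1).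
      by apply: quatP; rewrite !quatE; field.
    by apply: quatP; rewrite !quatE; field.
  exact: PM Pww (PM _ _ Pi Pw).
have Pk : P qk.
  rewrite (_ : qk = qi * qj); last by apply: quatP; rewrite !quatE; ring.
  exact: PM.
have sgn (x : int) : (odd `|x|)%N -> x ^+ 2 <= 1 ->
  {s : bool | x%:~R / 2 = (-1) ^+ s * 2^-1 :> R}.
  move=> ox x2; have [e|e] : {x = 1} + {x = -1}.
  - case: x ox x2 => n on n2.
      by left; move: n on n2 => [|[|n]] //; nia.
    by right; move: n on n2 => [|n] //; nia.
  - by exists false; rewrite e expr0 !mul1r.
  - by exists true; rewrite e expr1 intrN.
have half (s1 s2 s3 : bool) : P (mkquat (- 2^-1)
    ((-1) ^+ s1 * 2^-1) ((-1) ^+ s2 * 2^-1) ((-1) ^+ s3 * 2^-1)).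
  suff [x Px ->] : exists2 x, P x & mkquat (- 2^-1)
    ((-1) ^+ s1 * 2^-1) ((-1) ^+ s2 * 2^-1) ((-1) ^+ s3 * 2^-1) = x by [].
  case: s1 s2 s3 => [] [] []; rewrite !(expr0, expr1, mul1r, mulN1r).
  - by exists (qw * qw) => //; apply: quatP; rewrite !quatE; field.
  - by exists (qw * qj); [exact: PM|apply: quatP; rewrite !quatE; field].
  - by exists (qw * qi); [exact: PM|apply: quatP; rewrite !quatE; field].
  - by exists (- (qw * qw * qj)); [exact/PN/PM|apply: quatP; rewrite !quatE; field].
  - by exists (qw * qk); [exact: PM|apply: quatP; rewrite !quatE; field].
  - by exists (- (qw * qw * qk)); [exact/PN/PM|apply: quatP; rewrite !quatE; field].
  - by exists (- (qw * qw * qi)); [exact/PN/PM|apply: quatP; rewrite !quatE; field].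
  - by exists qw => //; apply: quatP; rewrite !quatE; field.
move=> q uq; have [[a [b [c [d [m qE]]]]] _] := uq.
move: uq; rewrite qE => /hurwitz_unit_sum_sqr s4.
have [om|em] := boolP (odd `|m|)%N.
  have o1 (x : int) : (odd `|(2 * x + m)%R|)%N /\ 1 <= (2 * x + m) ^+ 2.
    have ox : (odd `|(2 * x + m)%R|)%N by clear -om; lia.
    by split=> //; apply: sqr_int_ge1; clear -ox; lia.
  have [[oa a1] [ob b1] [oc c1] [od d1]] := And4 (o1 a) (o1 b) (o1 c) (o1 d).
  have [s0 h0] := sgn _ oa ltac:(clear -s4 a1 b1 c1 d1; lia).
  have [s1 h1] := sgn _ ob ltac:(clear -s4 a1 b1 c1 d1; lia).
  have [s2 h2] := sgn _ oc ltac:(clear -s4 a1 b1 c1 d1; lia).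
  have [s3 h3] := sgn _ od ltac:(clear -s4 a1 b1 c1 d1; lia).
  have e (x : int) : x%:~R + m%:~R / 2 = (2 * x + m)%:~R / 2 :> R.
    by rewrite intrD intrM; field.
  rewrite !e h0 h1 h2 h3; case: s0 {h0}; first by rewrite expr1 mulN1r.
  rewrite (_ : mkquat _ _ _ _ = - mkquat (- 2^-1) ((-1) ^+ (~~ s1) * 2^-1)
    ((-1) ^+ (~~ s2) * 2^-1) ((-1) ^+ (~~ s3) * 2^-1)); first exact/PN.
  apply: quatP; rewrite !quatE ?expr0 ?mul1r ?opprK //.
  - by case: (s1); rewrite /= ?expr0 ?expr1; ring.
  - by case: (s2); rewrite /= ?expr0 ?expr1; ring.
  - by case: (s3); rewrite /= ?expr0 ?expr1; ring.
have [k mk] : {k : int | m = 2 * k}.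
  by exists (m %/ 2)%Z; have := divz_eq m 2; lia.
have e (x : int) : x%:~R + m%:~R / 2 = (x + k)%:~R :> R.
  by rewrite mk intrD intrM; field.
rewrite !e.
have : (a + k) ^+ 2 + (b + k) ^+ 2 + (c + k) ^+ 2 + (d + k) ^+ 2 = 1.
  have e4 (x : int) : (2 * x + m) ^+ 2 = 4 * (x + k) ^+ 2 by rewrite mk; ring.
  by move: s4; rewrite !e4; clear; lia.
move: (a + k) (b + k) (c + k) (d + k) => A B C D s1.
have sq1 (x y z t : int) : x ^+ 2 + y ^+ 2 + z ^+ 2 + t ^+ 2 = 1 -> x != 0 ->
    [/\ (x = 1) \/ (x = -1), y = 0, z = 0 & t = 0].
  move=> h /sqr_int_ge1 x1; have := sqr_ge0 y; have := sqr_ge0 z.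
  have := sqr_ge0 t => t0 z0 y0.
  have sq0 (u : int) : u ^+ 2 = 0 -> u = 0 by move/eqP; rewrite sqrf_eq0 => /eqP.
  split; [|by apply: sq0; clear -h x1 y0 z0 t0; lia..].
  have /eqP : x ^+ 2 = 1 by clear -h x1 y0 z0 t0; lia.
  by rewrite sqrf_eq1 => /orP[] /eqP ->; [left|right].
have pm (x : int) u : (x = 1) \/ (x = -1) -> P u -> P (x%:~R *: u).
  by move=> [] -> Pu; rewrite ?scale1r // intrN scaleN1r; apply: PN.
have [A0|A0] := eqVneq A 0; last first.
  have [hA -> -> ->] := sq1 _ _ _ _ s1 A0.
  rewrite (_ : mkquat _ _ _ _ = A%:~R *: (1 : quat R)); first exact: pm.
  by apply: quatP; rewrite !quatE; ring.
have [B0|B0] := eqVneq B 0; last first.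
  have [hB C0 D0 _] : [/\ (B = 1) \/ (B = -1), C = 0, D = 0 & A = 0].
    by apply: sq1 => //; rewrite -s1; ring.
  rewrite A0 C0 D0 (_ : mkquat _ _ _ _ = B%:~R *: qi); first exact: pm.
  by apply: quatP; rewrite !quatE; ring.
have [C0|C0] := eqVneq C 0; last first.
  have [hC D0 _ _] : [/\ (C = 1) \/ (C = -1), D = 0, A = 0 & B = 0].
    by apply: sq1 => //; rewrite -s1; ring.
  rewrite A0 B0 D0 (_ : mkquat _ _ _ _ = C%:~R *: qj); first exact: pm.
  by apply: quatP; rewrite !quatE; ring.
rewrite A0 B0 C0 (_ : mkquat _ _ _ _ = D%:~R *: qk).
  apply: pm => //; move: s1; rewrite A0 B0 C0 expr0n !add0r => /eqP.
  by rewrite sqrf_eq1 => /orP[] /eqP ->; [left|right].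
by apply: quatP; rewrite !quatE; ring.
Qed.

End Hurwitz.

(** * The binary tetrahedral group and the special basis *)

Section Tetrahedral.
Variable R : realType.
Implicit Types p q I J : quat R.

Lemma omega_frame I J : omega I J = frame I J (qw R).
Proof.
rewrite /omega /frame; set K := I * J; clearbody K.
by apply: quatP; rewrite !quatE; field.
Qed.

Lemma hurwitz_unitV q : hurwitz_unit q -> hurwitz_unit q^-1.
Proof.
move=> [[a [b [c [d [m qE]]]]] n1].
have -> : q^-1 = qconj q.
  by rewrite [LHS](_ : _ = qinv q) // /qinv n1 invr1 scale1r.
split; last by rewrite qdotE !quatE -[RHS]n1 qdotE; ring.
rewrite qE; exists (a + m), (- b), (- c), (- d), (- m).
by apply: quatP; rewrite !quatE; field.
Qed.

(** One inclusion holds because the norm one Hurwitz integers form a group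
    containing i and w, the other because i and w generate it. *)
Lemma binary_tetrahedralE I J : imag_units I -> imag_units J ->
  qdot I J = 0 ->
  binary_tetrahedral I J = frame I J @` (@hurwitz_unit R).
Proof.
move=> uI uJ oIJ; apply/seteqP; split.
- apply: smallest_sub.
    split.
    + by move=> _ [q [_ n1] <-]; apply/S3P; rewrite qdot_frame.
    + by exists 1; [exact: hurwitz_unit1|exact: frame1].
    + move=> _ _ [p up <-] [q uq <-]; exists (p * q).
        exact: hurwitz_unitM.
      exact: frameM.
    + move=> _ [q uq <-]; exists q^-1; first exact: hurwitz_unitV.
      exact: frameV.
  move=> q [] ->; first by exists (qi R); [exact: hurwitz_unit_i|exact: frame_i].
  by exists (qw R); [exact: hurwitz_unit_w|rewrite omega_frame].
- move=> _ [q uq <-] G [[_ _ GM _] sG].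
  apply: (@hurwitz_unit_ind R (fun q => G (frame I J q))) uq.
  + by apply: sG; left; rewrite /qi frame_i.
  + by apply: sG; right; rewrite omega_frame.
  + by move=> p r; rewrite frameM //; exact: GM.
Qed.

Definition hurwitz_basis I J : 4.-tuple (quat R) :=
  [tuple 1; - omega I J; - I; I * omega I J].

Lemma sum4E (V : zmodType) (F : 'I_4 -> V) :
  \sum_i F i = F 0 + F 1 + F 2 + F 3.
Proof.
rewrite !big_ord_recl big_ord0 addr0 !addrA.
by congr (F _ + F _ + F _ + F _); apply/val_inj.
Qed.

Lemma hurwitz_basis_sum I J (n : 'I_4 -> R) :
  imag_units I -> imag_units J -> qdot I J = 0 ->
  \sum_i n i *: tnth (hurwitz_basis I J) i =
  frame I J (mkquat (n 0 + (n 1 - n 3) / 2) (- n 2 - (n 1 + n 3) / 2)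
                    (- (n 1 + n 3) / 2) ((n 3 - n 1) / 2)).
Proof.
move=> uI uJ oIJ; rewrite sum4E !(tnth_nth 0) /=.
have -> : I * omega I J = frame I J (qi R * qw R).
  by rewrite frameM // omega_frame /qi frame_i.
have -> : - I = frame I J (- qi R) by rewrite frameN // /qi frame_i.
rewrite omega_frame -frameN // -[X in n 0 *: X](frame1 I J) -!frameZ // -!frameD //.
by congr frame; apply: quatP; rewrite !quatE; field.
Qed.

Lemma hurwitz_basis_free I J :
  imag_units I -> imag_units J -> qdot I J = 0 -> free (hurwitz_basis I J).
Proof.
move=> uI uJ oIJ; apply/freeP => k.
under eq_bigr do rewrite -tnth_nth.
rewrite hurwitz_basis_sum // => /eqP.
rewrite frame_eq0 // => /eqP e.
have := congr1 (fun x : quat R => x 0 0) e; have := congr1 (fun x : quat R => x 0 1) e.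
have := congr1 (fun x : quat R => x 0 2) e; have := congr1 (fun x : quat R => x 0 3) e.
rewrite !quatE => e3 e2 e1 e0.
have k0 : k 0 = 0 by lra.
have k1 : k 1 = 0 by lra.
have k2 : k 2 = 0 by lra.
have k3 : k 3 = 0 by lra.
move=> [[|[|[|[|//]]]] i4].
- by rewrite -[RHS]k0; congr k; apply/val_inj.
- by rewrite -[RHS]k1; congr k; apply/val_inj.
- by rewrite -[RHS]k2; congr k; apply/val_inj.
- by rewrite -[RHS]k3; congr k; apply/val_inj.
Qed.

Lemma ZspanE (v : 4.-tuple (quat R)) (n : 'I_4 -> int) :
  \sum_i tnth v i *~ n i = \sum_i (n i)%:~R *: tnth v i.
Proof. by apply: eq_bigr => i _; rewrite scaler_int. Qed.

Lemma Zspan_hurwitz I J :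
  imag_units I -> imag_units J -> qdot I J = 0 ->
  Zspan (hurwitz_basis I J) = frame I J @` (@hurwitz R).
Proof.
move=> uI uJ oIJ; apply/seteqP; split=> [_ [n ->]|_ [_ [a [b [c [d [m ->]]]]] <-]].
  rewrite ZspanE hurwitz_basis_sum //; eexists; last by [].
  exists (n 0 - n 3), (- n 2 - (n 1 + n 3)), (- (n 1 + n 3)), (- n 1), (n 1 + n 3).
  by apply: quatP; rewrite !quatE; field.
(* The coordinates given by hurwitz_basis_sum, solved for the coefficients. *)
exists (tnth [tuple a + d + m; - (c + d + m); c - b; d - c]).
rewrite ZspanE hurwitz_basis_sum //; congr frame; rewrite !(tnth_nth 0) /=.
by apply: quatP; rewrite !quatE; field.
Qed.

(** The squared length of an integral combination of the basis is an integer,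
    and it is positive unless the combination is trivial; the basis vectors
    having length one, this is the Minkowski condition. *)
Lemma hurwitz_basis_special I J :
  imag_units I -> imag_units J -> qdot I J = 0 ->
  special_basis (hurwitz_basis I J).
Proof.
move=> uI uJ oIJ; split; [exact: hurwitz_basis_free| |by rewrite (tnth_nth 0)].
have normE (n : 'I_4 -> R) :
    qdot (\sum_i n i *: tnth (hurwitz_basis I J) i)
         (\sum_i n i *: tnth (hurwitz_basis I J) i) =
    n 0 ^+ 2 + n 1 ^+ 2 + n 2 ^+ 2 + n 3 ^+ 2
    + n 0 * n 1 + n 1 * n 2 + n 2 * n 3 - n 0 * n 3.
  by rewrite hurwitz_basis_sum // qdot_frame // qdotE !quatE; field.
have quadE (n : 'rV[R]_4) : (n *m gram (hurwitz_basis I J) *m n^T) 0 0 =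
    qdot (\sum_i n 0 i *: tnth (hurwitz_basis I J) i)
         (\sum_i n 0 i *: tnth (hurwitz_basis I J) i).
  pose V : 'M[R]_4 := \matrix_i tnth (hurwitz_basis I J) i.
  have -> : gram (hurwitz_basis I J) = V *m V^T.
    apply/matrixP => i j; rewrite !mxE; apply: eq_bigr => k _.
    by rewrite !mxE.
  have -> : \sum_i n 0 i *: tnth (hurwitz_basis I J) i = n *m V.
    by rewrite mulmx_sum_row; apply: eq_bigr => i _; rewrite rowK.
  rewrite mulmxA -mulmxA -trmx_mul mxE; apply: eq_bigr => i _.
  by congr (_ * _); rewrite [LHS]mxE.
have dotE p q : qdot (frame I J p) (frame I J q) = qdot p q.
  have pol (x y : quat R) :
      qdot (x + y) (x + y) = qdot x x + qdot y y + 2 * qdot x y.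
    by rewrite !qdotE !quatE; ring.
  have := pol (frame I J p) (frame I J q).
  by rewrite -frameD // !qdot_frame // pol; lra.
have basisE (i : 'I_4) : tnth (hurwitz_basis I J) i = frame I J
    (tnth [tuple 1; - qw R; - qi R; qi R * qw R] i).
  rewrite !(tnth_nth 0); case: i => [[|[|[|[|//]]]]] i4 /=.
  - by rewrite frame1.
  - by rewrite frameN // omega_frame.
  - by rewrite frameN // /qi frame_i.
  - by rewrite frameM // omega_frame /qi frame_i.
split.
- move=> [[|[|[|[|//]]]] i4] [[|[|[|[|//]]]] j4] //= _; rewrite mxE !basisE dotE;
    by rewrite !(tnth_nth 0) /= qdotE !quatE; lra.
- move=> k n gn /=; rewrite quadE mxE.
  have -> : qdot (tnth (hurwitz_basis I J) k) (tnth (hurwitz_basis I J) k) = 1.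
    rewrite !basisE dotE !(tnth_nth 0) /=; case: k {gn} => [[|[|[|[|//]]]]] i4 /=;
      by rewrite qdotE !quatE; field.
  set x := \sum_i _.
  have x0 : 0 < qdot x x.
    rewrite qdot_gt0; apply/eqP => xe.
    have fr := hurwitz_basis_free uI uJ oIJ.
    have n0 i : n 0 i = 0.
      move/freeP/(_ (fun i => (n 0 i)%:~R)) : fr => /(_ _ i) h.
      apply: (@intr_inj R); apply: h; rewrite -[RHS]xe.
      by apply: eq_bigr => j _; rewrite mxE (tnth_nth 0).
    move: gn; rewrite (big_ind (fun x => x = 0)) // => a b -> ->.
    exact: gcdz0.
  move: x0; rewrite /x normE.
  rewrite ![map_mx _ _ _ _]mxE -!(rmorphXn, rmorphD, rmorphM, rmorphB) /=.
  by rewrite (ltr_int _ 0) (ler_int _ 1).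
Qed.

End Tetrahedral.

(** * Lattices *)

Section LatticeFacts.
Variable R : realType.
Implicit Types (p q x : quat R) (L : lattice R).

Lemma norm_coord_le q i : `|q 0 i| <= `|q|.
Proof.
rewrite [leRHS]/Num.norm /= mx_normrE.
by apply/bigmax_geP; right => /=; exists (0, i).
Qed.

Lemma norm_sqr_le q : `|q| ^+ 2 <= qdot q q.
Proof.
have [->|q0] := eqVneq q 0; first by rewrite normr0 expr0n qdot_ge0.
have [|[i j] /=] := @mx_norm_neq0 _ _ _ q.
  by apply: contra_neq q0; exact: mx_norm_eq0.
rewrite [mx_norm q](_ : _ = `|q|) // (ord1 i) => ->.
rewrite real_normK ?num_real // /qdot (bigD1 j) //= expr2 lerDl.
by rewrite sumr_ge0 // => k _; rewrite -expr2 sqr_ge0.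
Qed.

Lemma lattice0 L : lattice_set L 0.
Proof.
have [v _ ->] := latticeP L; exists (fun=> 0).
by rewrite big1 // => i _; rewrite mulr0z.
Qed.

Lemma latticeB L x q : lattice_set L x -> lattice_set L q -> lattice_set L (x - q).
Proof.
have [v _ ->] := latticeP L => -[m ->] [n ->]; exists (fun i => m i - n i).
by rewrite -sumrB; apply: eq_bigr => i _; rewrite mulrzBr.
Qed.

Lemma latticeN L x : lattice_set L x -> lattice_set L (- x).
Proof. by move=> Lx; rewrite -sub0r; apply: latticeB => //; exact: lattice0. Qed.

Lemma latticeD L x q : lattice_set L x -> lattice_set L q -> lattice_set L (x + q).
Proof. by move=> Lx Lq; rewrite -[q]opprK; apply/latticeB/latticeN. Qed.

Lemma lattice_mulrz L x (n : int) : lattice_set L x -> lattice_set L (x *~ n).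
Proof.
move=> Lx; have nat k : lattice_set L (x *+ k).
  by elim: k => [|k ih]; [exact: lattice0|rewrite mulrS; exact: latticeD].
by case: n => k; [exact: nat|rewrite NegzE mulrNz; exact/latticeN/nat].
Qed.

(** A lattice is discrete: the coordinates of a small vector are smaller than
    one, and an integer smaller than one is zero. *)
Lemma lattice_gap L : exists2 rho : R, 0 < rho &
  forall x, lattice_set L x -> `|x| < rho -> x = 0.
Proof.
have [v fv LE] := latticeP L.
pose C i : R := \sum_j `|coord v i (delta_mx 0 j : quat R)|.
have Cge i : 0 <= C i by apply: sumr_ge0.
have Cle i x : `|coord v i x| <= `|x| * C i.
  rewrite {1}(row_sum_delta x) linear_sum /= mulr_sumr.
  apply: (le_trans (ler_norm_sum _ _ _)); apply: ler_sum => j _.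
  by rewrite linearZ /= normrM ler_wpM2r // norm_coord_le.
pose D : R := 1 + \sum_i C i.
have D0 : 0 < D by rewrite ltr_pwDl // sumr_ge0.
exists D^-1; first by rewrite invr_gt0.
rewrite LE => _ [n ->]; set x := (X in `|X|) => xD.
have n0 i : n i = 0.
  have e : coord v i x = (n i)%:~R.
    rewrite /x; under eq_bigr do rewrite -scaler_int (tnth_nth 0).
    exact: coord_sum_free.
  suff : `|n i| < 1 by lia.
  rewrite -(ltr_int R) intr_norm -e.
  apply: le_lt_trans (Cle i x) _.
  have CD : C i < D.
    rewrite /D (bigD1 i) //=.
    have : 0 <= \sum_(j | j != i) C j by apply: sumr_ge0.
    lra.
  have := normr_ge0 x; rewrite le_eqVlt => /orP[/eqP <-|x0]; first by rewrite mul0r.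
  apply: lt_trans (_ : `|x| * D < 1); first by rewrite ltr_pM2l.
  by rewrite -ltr_pdivlMr // mul1r.
by rewrite /x big1 // => i _; rewrite n0 mulr0z.
Qed.

End LatticeFacts.

(** * Lattices with tetrahedral symmetry *)

Section HurwitzModules.
Variable R : realType.
Implicit Types (p q x I J : quat R) (L : lattice R).

(** The orders of a, b and a b prescribe their real parts, hence
    b = -1/2 + a/2 + P with P orthogonal to 1 and a; then J is the solution
    (1 - a) P of the equation (1 + a) J = 2 P. *)
Lemma omega_recover (a b : quat R) : a * a = -1 -> b * b * b = 1 -> b <> 1 ->
  a * b * (a * b) * (a * b) = 1 -> a * b <> 1 ->
  exists2 J, imag_units J /\ qdot a J = 0 & omega a J = b.
Proof.
move=> aa b3 b1 c3 c1.
have /imag_unitsP[a0 na] : imag_units a by rewrite /imag_units /= expr2.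
have [b0 nb] := cube_root1 b3 b1; have [c0 _] := cube_root1 c3 c1.
pose P := b + 2^-1 *: (1 : quat R) - 2^-1 *: a.
have ab : qdot a b = 2^-1.
  by move: c0; rewrite qdotE !quatE a0 b0; lra.
have P0 : P 0 0 = 0 by rewrite /P !quatE a0 b0; field.
have aP : qdot a P = 0.
  transitivity (qdot a b + 2^-1 * a 0 0 - 2^-1 * qdot a a).
    by rewrite !qdotE !quatE; ring.
  by rewrite ab a0 na; field.
have nP : qdot P P = 2^-1.
  transitivity (qdot P b + 2^-1 * P 0 0 - 2^-1 * qdot a P).
    by rewrite !qdotE /P !quatE; ring.
  rewrite P0 aP; transitivity (qdot b b + 2^-1 * b 0 0 - 2^-1 * qdot a b).
    by rewrite !qdotE /P !quatE; ring.
  by rewrite nb b0 ab; field.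
exists ((1 - a) * P).
  split.
    apply/imag_unitsP; split.
      transitivity ((1 - a 0 0) * P 0 0 + (qdot a P - a 0 0 * P 0 0)).
        by rewrite !qdotE !quatE; ring.
      by rewrite a0 P0 aP; ring.
    rewrite qdot_mul nP.
    transitivity ((1 - 2 * a 0 0 + qdot a a) / 2).
      by rewrite !qdotE !quatE; field.
    by rewrite a0 na; field.
  transitivity (qdot a P - qdot a a * P 0 0).
    by rewrite !qdotE !quatE; ring.
  by rewrite aP P0; ring.
rewrite /omega.
have -> : a * ((1 - a) * P) = (1 + a) * P.
  by rewrite mulrA; congr (_ * _); rewrite mulrBr mulr1 aa opprK addrC.
rewrite -addrA -mulrDl (_ : 1 - a + (1 + a) = 2%:R *: (1 : quat R)).
  by rewrite -scaleqAl mul1r /P; apply: quatP; rewrite !quatE; field.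
by apply: quatP; rewrite !quatE; ring.
Qed.

Lemma lattice_hurwitz L I J :
  imag_units I -> imag_units J -> qdot I J = 0 ->
  (forall x, lattice_set L x -> lattice_set L (x * I)) ->
  (forall x, lattice_set L x -> lattice_set L (x * omega I J)) ->
  forall x h, lattice_set L x -> hurwitz h -> lattice_set L (x * frame I J h).
Proof.
move=> uI uJ oIJ LI Lw x h Lx hh.
have : Zspan (hurwitz_basis I J) (frame I J h).
  by rewrite Zspan_hurwitz //; exists h.
move=> [n ->]; rewrite sum4E !mulrDr !(tnth_nth 0) /= !mulrzAr mulr1.
do 3?apply: latticeD; apply: lattice_mulrz => //.
- by rewrite mulrN; apply/latticeN/Lw.
- by rewrite mulrN; apply/latticeN/LI.
- by rewrite mulrA; apply/Lw/LI.
Qed.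

(** Take for l a nonzero vector whose squared length is less than twice the
    infimum of the squared lengths of such vectors. Every x in L is within
    squared distance |l|^2 / 2 of l times the Hurwitz order; the difference lies
    in L and is too short to be nonzero. *)
Lemma lattice_hurwitz_principal L I J :
  imag_units I -> imag_units J -> qdot I J = 0 ->
  (forall x, lattice_set L x -> lattice_set L (x * I)) ->
  (forall x, lattice_set L x -> lattice_set L (x * omega I J)) ->
  exists2 l, l != 0 &
    forall x, lattice_set L x <-> exists2 h, hurwitz h & x = l * frame I J h.
Proof.
move=> uI uJ oIJ LI Lw; have LH := lattice_hurwitz uI uJ oIJ LI Lw.
pose S : set R := [set r | exists x, [/\ lattice_set L x, x != 0 & r = qdot x x]].
have [rho rho0 gap] := lattice_gap L.
have Slb : lbound S (rho ^+ 2).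
  move=> _ [x [Lx x0 ->]]; apply: le_trans (norm_sqr_le x).
  rewrite ler_pXn2r ?nnegrE //; last exact: ltW.
  by rewrite leNgt; apply: contra x0 => /(gap _ Lx) ->.
have Sinf : has_inf S.
  split; last by exists (rho ^+ 2).
  have [v fv LE] := latticeP L.
  exists (qdot (tnth v 0) (tnth v 0)), (tnth v 0); split=> //.
    rewrite LE; exists (fun i => (i == 0)%:Z).
    rewrite (bigD1 0) //= big1 ?addr0 // => i i0.
    by rewrite (negbTE i0) mulr0z.
  by rewrite (tnth_nth 0); apply: (free_not0 fv); rewrite mem_nth // size_tuple.
have inf0 : 0 < inf S.
  apply: lt_le_trans (_ : rho ^+ 2 <= _); first by rewrite exprn_gt0.
  by apply: lb_le_inf => //; case: Sinf.
have [_ [l [Ll l0 ->]] lS] := inf_adherent inf0 Sinf.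
exists l => // x; split=> [Lx|[h hh ->]]; last exact: LH.
have [y yE] := frame_surj uI uJ oIJ (l^-1 * x).
have [h hh yh] := hurwitz_round y.
exists h => //; apply/eqP; rewrite -subr_eq0; apply/negPn/negP => r0.
have lu : l \is a GRing.unit by rewrite quat_unitE.
have rE : x - l * frame I J h = l * frame I J (y - h).
  by rewrite frameB // yE mulrBr mulVKr.
have : inf S <= qdot (x - l * frame I J h) (x - l * frame I J h).
  apply: ge_inf; first by case: Sinf.
  by exists (x - l * frame I J h); split => //; apply/latticeB/LH.
rewrite rE qdot_mul qdot_frame //; apply/negP; rewrite -ltNge.
apply: le_lt_trans (_ : qdot l l * 2^-1 < _).
  by rewrite ler_wpM2l // qdot_ge0.
move: lS; lra.
Qed.

End HurwitzModules.

(** * Right multiplications induce biregular maps of tori *)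

Section MulRegular.
Variable R : realType.
Implicit Types (p q x a I : quat R) (L : lattice R).

Lemma continuous_coord (i : 'I_4) : continuous (fun q : quat R => q 0 i).
Proof. exact: (@coord_continuous R 1 4 0 i). Qed.

Lemma continuous_qmulr a : continuous (fun q : quat R => q * a).
Proof.
move=> q.
have -> : (fun q => q * a) = fun q : quat R => q 0 0 *: a + q 0 1 *: (qi R * a)
    + q 0 2 *: (qj R * a) + q 0 3 *: (qk R * a).
  by apply/funext => x; apply: quatP; rewrite !quatE; ring.
have c (i : 'I_4) (b : quat R) :
    {for q, continuous (fun x : quat R => x 0 i *: b)}.
  by apply: continuousZr_tmp; exact: continuous_coord.
exact: continuousD (continuousD (continuousD (c 0 a) (c 1 (qi R * a)))
  (c 2 (qj R * a))) (c 3 (qk R * a)).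
Qed.

Lemma continuous_slice_point I : continuous (slice_point I).
Proof.
move=> z; rewrite /slice_point; apply: cvgD; apply: cvgZr_tmp.
  exact: cvg_fst.
exact: cvg_snd.
Qed.

Lemma proj_eq L p q : (Defs.proj L p = Defs.proj L q) <-> lattice_set L (p - q).
Proof.
rewrite /proj; split; first by move=> /eqmodP /asboolP.
by move=> h; apply/eqmodP/asboolP.
Qed.

Lemma projD L p x : lattice_set L x -> Defs.proj L (p + x) = Defs.proj L p.
Proof. by move=> Lx; apply/proj_eq; rewrite addrC addKr. Qed.

Lemma proj_surj L (t : torus L) : exists q, Defs.proj L q = t.
Proof. by exists (repr t); rewrite /Defs.proj reprK. Qed.

Lemma chartK L V q : chart_dom L V -> V q -> chart V (Defs.proj L q) = q.
Proof. by move=> [_ _ inj] Vq; apply: pinvKV => //; rewrite inE. Qed.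

Lemma is_derive_affine (d1 d2 c : quat R) (z v : R * R) :
  is_derive z v (fun w : R * R => w.1 *: d1 + w.2 *: d2 + c)
    (v.1 *: d1 + v.2 *: d2).
Proof.
have l : (fun h : R => h^-1 *: (((fun w : R * R => w.1 *: d1 + w.2 *: d2 + c)
    \o shift z) (h *: v) - (z.1 *: d1 + z.2 *: d2 + c))) @ 0^' -->
    (v.1 *: d1 + v.2 *: d2).
  apply: cvg_near_cst; near=> h.
  have h0 : h != 0 by near: h; exact: nbhs_dnbhs_neq.
  rewrite /= [X in X - _](_ : _ = h *: (v.1 *: d1 + v.2 *: d2) +
    (z.1 *: d1 + z.2 *: d2 + c)); last first.
    have -> : h *: v.1 + z.1 = h * v.1 + z.1 by [].
    have -> : h *: v.2 + z.2 = h * v.2 + z.2 by [].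
    by apply: quatP; rewrite !quatE; ring.
  by rewrite addrK scalerA mulVf // scale1r.
by apply: DeriveDef; [apply/cvg_ex; eexists; exact: l|exact: cvg_lim l].
Unshelve. all: by end_near.
Qed.

(** In the charts, right multiplication is z -> z a + lambda on each slice,
    with lambda in the target lattice; its derivatives are the constants
    a and I a, and a + I (I a) = 0. *)
Lemma mulr_regular L1 L2 a (F : torus L1 -> torus L2) :
  (forall q, F (Defs.proj L1 q) = Defs.proj L2 (q * a)) -> regular_map F.
Proof.
move=> FE U V dU dV; have [oU _ _] := dU; have [oV _ _] := dV.
set Om := U `&` _.
have loc q0 : Om q0 -> exists lam, \forall q \near q0,
    Om q /\ chart V (F (Defs.proj L1 q)) = q * a + lam.
  move=> [Uq0 [w Vw]]; rewrite FE => /proj_eq Lw.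
  exists (w - q0 * a).
  have Vn : \forall q \near q0, V (q * a + (w - q0 * a)).
    have c : {for q0, continuous (fun q : quat R => q * a + (w - q0 * a))}.
      by apply: continuousD; [exact: continuous_qmulr|exact: cst_continuous].
    apply: c; apply: open_nbhs_nbhs; split => //.
    by rewrite addrC subrK.
  have Un : \forall q \near q0, U q by apply: open_nbhs_nbhs.
  near=> q.
  have Vq : V (q * a + (w - q0 * a)) by near: q.
  have pq : F (Defs.proj L1 q) = Defs.proj L2 (q * a + (w - q0 * a)).
    by rewrite FE projD.
  split; last by rewrite pq chartK.
  split; first by near: q.
  by rewrite /= pq; exists (q * a + (w - q0 * a)).
split.
  rewrite openE => q0 /loc[lam h].
  by apply: filterS h => q [].
move=> I uI fI OmI.
have der z : OmI z -> forall v,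
    is_derive z v fI (v.1 *: a + v.2 *: (I * a)).
  move=> Oz v; have [lam h] := loc _ Oz.
  apply: near_eq_is_derive (is_derive_affine a (I * a) lam z v).
  have h' : \forall w \near z, Om (slice_point I w) /\
      fI w = slice_point I w * a + lam by exact: (continuous_slice_point h).
  apply: filterS h' => w [_ ->].
  by rewrite /slice_point mulrDl -!scaleqAl mul1r.
have D10 z : OmI z -> 'D_(1, 0) fI z = a.
  by move=> /der/(_ (1, 0)) h; rewrite derive_val /= scale1r scale0r addr0.
have D01 z : OmI z -> 'D_(0, 1) fI z = I * a.
  by move=> /der/(_ (0, 1)) h; rewrite derive_val /= scale1r scale0r add0r.
split.
- move=> z Oz; split; first by have [] := der _ Oz (1, 0).
  by have [] := der _ Oz (0, 1).
- apply/subspace_continuousP => z Oz.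
  suff : 'D_(1, 0) fI w @[w --> within OmI (nbhs z)] --> 'D_(1, 0) fI z by [].
  rewrite (D10 _ Oz).
  apply: cvg_near_cst; rewrite near_withinE; near=> w => Ow.
  by rewrite D10.
- apply/subspace_continuousP => z Oz.
  suff : 'D_(0, 1) fI w @[w --> within OmI (nbhs z)] --> 'D_(0, 1) fI z by [].
  rewrite (D01 _ Oz).
  apply: cvg_near_cst; rewrite near_withinE; near=> w => Ow.
  by rewrite D01.
- move=> z Oz; rewrite D10 // D01 // mulrA -expr2 uI mulN1r subrr.
  exact: scaler0.
Unshelve. all: by end_near.
Qed.

Lemma mulr_equivalent L1 L2 a : a != 0 ->
  (forall x, lattice_set L1 x <-> lattice_set L2 (x * a)) ->
  equivalent_tori L1 L2.
Proof.
move=> a0 La; have ua : a \is a GRing.unit by rewrite quat_unitE.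
have wd (M1 M2 : lattice R) b :
    (forall x, lattice_set M1 x -> lattice_set M2 (x * b)) ->
    forall q, Defs.proj M2 (repr (Defs.proj M1 q) * b) = Defs.proj M2 (q * b).
  move=> Mb q; apply/proj_eq; rewrite -mulrBl; apply: Mb.
  by apply/proj_eq; rewrite /Defs.proj reprK.
have FE := wd L1 L2 a (fun x => proj1 (La x)).
have GE : forall q, Defs.proj L1 (repr (Defs.proj L2 q) * a^-1) = Defs.proj L1 (q * a^-1).
  by apply: wd => x Lx; apply/La; rewrite divrK.
exists (fun t => Defs.proj L2 (repr t * a)); split; first exact: mulr_regular FE.
exists (fun t => Defs.proj L1 (repr t * a^-1)); split; last exact: mulr_regular GE.
- by move=> t; have [q <-] := proj_surj t; rewrite FE GE mulrK.
- by move=> t; have [q <-] := proj_surj t; rewrite GE FE divrK.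
Qed.

End MulRegular.

(** * Functions of two real variables *)

Lemma continuous_at_pair (T U V : topologicalType) (f : T -> U) (g : T -> V) (t : T) :
  {for t, continuous f} -> {for t, continuous g} ->
  {for t, continuous (fun s => (f s, g s))}.
Proof.
move=> cf cg.
exact: (@cvg_pair T U V (nbhs t) (nbhs (f t)) (nbhs (g t)) _ _ _ f g cf cg).
Qed.

Section Partials.
Variable R : realType.

Lemma partial_fst (u : R * R -> R) (x y d : R) :
  is_derive ((x, y) : R * R) ((1, 0) : R * R) u d ->
  is_derive x (1 : R) (fun s => u (s, y)) d.
Proof.
move=> [du <-].
have E : (fun h : R => h^-1 *: (((fun s => u (s, y)) \o shift x) (h *: 1) - u (x, y))) =
    (fun h : R => h^-1 *: ((u \o shift (x, y)) (h *: (1, 0)) - u (x, y))).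
  apply/funext => h /=; congr (_ *: (u _ - _)).
  by congr (_, _); rewrite /= [X in _ = X + _]mulr0 add0r.
by apply: DeriveDef; [rewrite /derivable E|rewrite /derive E].
Qed.

Lemma partial_snd (u : R * R -> R) (x y d : R) :
  is_derive ((x, y) : R * R) ((0, 1) : R * R) u d ->
  is_derive y (1 : R) (fun s => u (x, s)) d.
Proof.
move=> [du <-].
have E : (fun h : R => h^-1 *: (((fun s => u (x, s)) \o shift y) (h *: 1) - u (x, y))) =
    (fun h : R => h^-1 *: ((u \o shift (x, y)) (h *: (0, 1)) - u (x, y))).
  apply/funext => h /=; congr (_ *: (u _ - _)).
  by congr (_, _); rewrite /= [X in _ = X + _]mulr0 add0r.
by apply: DeriveDef; [rewrite /derivable E|rewrite /derive E].
Qed.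

Lemma mean_value (f df : R -> R) (x y : R) :
  (forall c, `|c - x| <= `|y - x| -> is_derive c (1 : R) f (df c)) ->
  exists2 c, `|c - x| <= `|y - x| & f y - f x = df c * (y - x).
Proof.
move=> d.
have cf c : `|c - x| <= `|y - x| -> {for c, continuous f}.
  by move=> /d[dc _]; apply/differentiable_continuous/derivable1_diffP.
have [xy|/ltW yx] := leP x y.
  have xyE c : c \in `[x, y] -> `|c - x| <= `|y - x|.
    by rewrite in_itv /= => /andP[? ?]; rewrite !ger0_norm ?subr_ge0 // lerD2r.
  have [z zxy||c cxy ->] := @MVT_segment _ f df x y xy; last by exists c => //; exact: xyE.
    by apply/d/xyE; exact: subset_itv_oo_cc.
  apply: continuous_in_subspaceT => z; rewrite inE => zxy.
  by apply/cf/xyE.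
have yxE c : c \in `[y, x] -> `|c - x| <= `|y - x|.
  by rewrite in_itv /= => /andP[? ?]; rewrite !ler0_norm ?subr_le0 // lerN2 lerD2r.
have [z zxy||c cxy e] := @MVT_segment _ f df y x yx.
- by apply/d/yxE; exact: subset_itv_oo_cc.
- apply: continuous_in_subspaceT => z; rewrite inE => zxy.
  by apply/cf/yxE.
- by exists c; [exact: yxE|rewrite -opprB e -mulrN opprB].
Qed.

Variables (u ux uy : R * R -> R).
Hypothesis dux : forall z, is_derive (z : R * R) ((1, 0) : R * R) u (ux z).
Hypothesis duy : forall z, is_derive (z : R * R) ((0, 1) : R * R) u (uy z).
Hypotheses (cux : continuous ux) (cuy : continuous uy).

(** The increment of u is the one in the first variable plus the one in the
    second; each is, by the mean value theorem, a partial derivative at an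
    intermediate point times the increment of the variable. *)
Lemma chain_rule2 (g1 g2 : R -> R) (t d1 d2 : R) :
  is_derive t (1 : R) g1 d1 -> is_derive t (1 : R) g2 d2 ->
  is_derive t (1 : R) (fun s => u (g1 s, g2 s))
    (ux (g1 t, g2 t) * d1 + uy (g1 t, g2 t) * d2).
Proof.
move=> /is_derive1_caratheodory[k1 [e1 c1 k1t]].
move=> /is_derive1_caratheodory[k2 [e2 c2 k2t]].
have cg (g k : R -> R) : (forall z, g z - g t = k z * (z - t)) ->
    {for t, continuous k} -> {for t, continuous g}.
  move=> e c; have -> : g = fun z => k z * (z - t) + g t.
    by apply/funext => z; rewrite -e subrK.
  apply: continuousD; last exact: cst_continuous.
  by apply: continuousM => //; apply: continuousB; [exact: cvg_id|exact: cst_continuous].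
have cg1 := cg _ _ e1 c1; have cg2 := cg _ _ e2 c2.
have /choice[xi hxi] : forall s, exists c, `|c - g1 t| <= `|g1 s - g1 t| /\
    u (g1 s, g2 s) - u (g1 t, g2 s) = ux (c, g2 s) * (g1 s - g1 t).
  move=> s; have [c ? ?] := @mean_value _ _ (g1 t) (g1 s) (fun x _ => partial_fst (dux (x, g2 s))).
  by exists c.
have /choice[eta heta] : forall s, exists c, `|c - g2 t| <= `|g2 s - g2 t| /\
    u (g1 t, g2 s) - u (g1 t, g2 t) = uy (g1 t, c) * (g2 s - g2 t).
  move=> s; have [c ? ?] := @mean_value _ _ (g2 t) (g2 s) (fun y _ => partial_snd (duy (g1 t, y))).
  by exists c.
have squeeze (g h : R -> R) : {for t, continuous g} ->
    (forall s, `|h s - g t| <= `|g s - g t|) ->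
    h t = g t /\ {for t, continuous h}.
  move=> c b; have ht : h t = g t.
    by apply/eqP; rewrite -subr_eq0 -normr_le0; have := b t; rewrite subrr normr0.
  split=> //; apply/cvgrPdist_lt => e e0; rewrite ht.
  move/cvgrPdist_lt : c => /(_ e e0); apply: filterS => s.
  by rewrite ![`|g t - _|]distrC; exact: le_lt_trans.
have [xit cxi] := squeeze _ _ cg1 (fun s => proj1 (hxi s)).
have [etat ceta] := squeeze _ _ cg2 (fun s => proj1 (heta s)).
apply/is_derive1_caratheodory.
exists (fun s => ux (xi s, g2 s) * k1 s + uy (g1 t, eta s) * k2 s); split.
- move=> s; rewrite mulrDl -!mulrA -e1 -e2 -(proj2 (hxi s)) -(proj2 (heta s)).
  by rewrite addrA subrK.
- apply: continuousD; apply: continuousM => //.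
  + apply: (@continuous_comp _ _ _ (fun s => (xi s, g2 s)) ux); last exact: cux.
    exact: continuous_at_pair.
  + apply: (@continuous_comp _ _ _ (fun s => (g1 t, eta s)) uy); last exact: cuy.
    by apply: continuous_at_pair => //; exact: cst_continuous.
- by rewrite xit etat k1t k2t.
Unshelve. all: by end_near.
Qed.

End Partials.

(** * Liouville's theorem for Cauchy-Riemann pairs *)

(** The Cauchy formula for the derivative, without complex numbers. On the circle
    of radius r about z0, f is the real part of exp(-i t) (u + i v), so that its
    integral n(r) is 2 pi r ux(z0). *)
Section Liouville.
Variable R : realType.
Variables (u v ux uy : R * R -> R).
Hypothesis dux : forall z, is_derive (z : R * R) ((1, 0) : R * R) u (ux z).
Hypothesis duy : forall z, is_derive (z : R * R) ((0, 1) : R * R) u (uy z).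
Hypothesis dvx : forall z, is_derive (z : R * R) ((1, 0) : R * R) v (- uy z).
Hypothesis dvy : forall z, is_derive (z : R * R) ((0, 1) : R * R) v (ux z).
Hypotheses (cux : continuous ux) (cuy : continuous uy).

Let cuyN : continuous (fun z => - uy z).
Proof. by move=> z; apply: continuousN; exact: cuy. Qed.

Variable z0 : R * R.
Let circle (r t : R) : R * R := (z0.1 + r * cos t, z0.2 + r * sin t).
Let f (r t : R) : R := u (circle r t) * cos t + v (circle r t) * sin t.
Let k (r t : R) : R := u (circle r t) * sin t - v (circle r t) * cos t.

Let circle_r (g gx gy : R * R -> R) r t :
  (forall z, is_derive (z : R * R) ((1, 0) : R * R) g (gx z)) ->
  (forall z, is_derive (z : R * R) ((0, 1) : R * R) g (gy z)) ->
  continuous gx -> continuous gy ->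
  is_derive r (1 : R) (fun r => g (circle r t))
    (gx (circle r t) * cos t + gy (circle r t) * sin t).
Proof.
move=> dx dy cx cy; apply: (chain_rule2 dx dy cx cy).
  by apply: is_derive_eq; rewrite /GRing.scale /=; ring.
by apply: is_derive_eq; rewrite /GRing.scale /=; ring.
Qed.

Let circle_t (g gx gy : R * R -> R) r t :
  (forall z, is_derive (z : R * R) ((1, 0) : R * R) g (gx z)) ->
  (forall z, is_derive (z : R * R) ((0, 1) : R * R) g (gy z)) ->
  continuous gx -> continuous gy ->
  is_derive t (1 : R) (fun t => g (circle r t))
    (gx (circle r t) * (r * - sin t) + gy (circle r t) * (r * cos t)).
Proof.
move=> dx dy cx cy; apply: (chain_rule2 dx dy cx cy).
  by apply: is_derive_eq; rewrite /GRing.scale /=; ring.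
by apply: is_derive_eq; rewrite /GRing.scale /=; ring.
Qed.

Let sq t : cos t * cos t + sin t * sin t = 1 :> R.
Proof. by rewrite -!expr2 cos2Dsin2. Qed.

(** The terms in uy cancel by the Cauchy-Riemann equations. *)
Let df_r r t : is_derive r (1 : R) (f ^~ t) (ux (circle r t)).
Proof.
have du := circle_r r t dux duy cux cuy.
have dv := circle_r r t dvx dvy cuyN cux.
rewrite /f; apply: is_derive_eq; rewrite /GRing.scale /=.
by rewrite -[RHS]mulr1 -(sq t); ring.
Qed.

Let dk_t r t : is_derive t (1 : R) (k r) (f r t - r * ux (circle r t)).
Proof.
have du := circle_t r t dux duy cux cuy.
have dv := circle_t r t dvx dvy cuyN cux.
rewrite /k /f; apply: is_derive_eq; rewrite /GRing.scale /=.
by rewrite -[r * ux _]mulr1 -(sq t); ring.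
Qed.

Let continuous_circle (g : R * R -> R) r : continuous g ->
  continuous (fun t => g (circle r t)).
Proof.
move=> cg t; apply: (@continuous_comp _ _ _ (circle r) g); last exact: cg.
have c0 (a : R) : {for t, continuous (fun=> a)} by exact: cst_continuous.
apply: continuous_at_pair; apply: continuousD => //; apply: continuousM => //.
  exact: continuous_cos.
exact: continuous_sin.
Qed.

Let cf r : continuous (f r).
Proof.
move=> t.
have c (g gx gy : R * R -> R) :
    (forall z, is_derive (z : R * R) ((1, 0) : R * R) g (gx z)) ->
    (forall z, is_derive (z : R * R) ((0, 1) : R * R) g (gy z)) ->
    continuous gx -> continuous gy -> {for t, continuous (fun s => g (circle r s))}.
  move=> dx dy cx cy; apply/differentiable_continuous/derivable1_diffP.
  by have [] := circle_t r t dx dy cx cy.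
apply: (@continuousD _ _ _ (fun s => u (circle r s) * cos s)
  (fun s => v (circle r s) * sin s)); apply: continuousM.
- exact: c dux duy cux cuy.
- exact: continuous_cos.
- exact: c dvx dvy cuyN cux.
- exact: continuous_sin.
Qed.

Let mu := @lebesgue_measure R.
Let I : set R := `[0, 2 * pi].
Let n r := (\int[mu]_(t in I) f r t)%R.
Let m r := (\int[mu]_(t in I) ux (circle r t))%R.

Let pi2 : 0 < 2 * pi :> R.
Proof. by rewrite mulr_gt0 // pi_gt0. Qed.

Let integrable_continuous (g : R -> R) : continuous g -> mu.-integrable I (EFin \o g).
Proof.
move=> cg; apply: continuous_compact_integrable; first exact: segment_compact.
exact: continuous_subspaceT.
Qed.

(** The integrand f - r ux is the angular derivative of the periodic
    function k. *)
Let nE r : n r = r * m r.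
Proof.
have cr : continuous (fun t => f r t - r * ux (circle r t)).
  move=> t; apply: (@continuousB _ _ _ (f r) (fun s => r * ux (circle r s))).
    exact: cf.
  apply: continuousM; first exact: cst_continuous.
  exact: (@continuous_circle _ r cux t).
have : (\int[mu]_(t in I) (f r t - r * ux (circle r t)) = 0)%R.
  rewrite /Rintegral (@continuous_FTC2 _ _ (k r)) //.
  - rewrite /k /circle mulr_natl cos2pi sin2pi cos0 sin0 /=.
    by rewrite subrr.
  - exact: continuous_subspaceT.
  - have ck t : {for t, continuous (k r)}.
      apply/differentiable_continuous/derivable1_diffP.
      by have [] := dk_t r t.
    split.
    + by move=> t _; have [] := dk_t r t.
    + exact: cvg_at_right_filter (ck 0).
    + exact: cvg_at_left_filter (ck _).
  - by move=> t _; rewrite derive1E; have := dk_t r t => h; rewrite derive_val.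
have iux := integrable_continuous (@continuous_circle _ r cux).
have irux : mu.-integrable I (EFin \o (fun t => r * ux (circle r t))).
  apply: integrable_continuous => t; apply: continuousM; first exact: cst_continuous.
  exact: (@continuous_circle _ r cux t).
rewrite (RintegralB _ (integrable_continuous (@cf r)) irux); last exact: measurable_itv.
rewrite (RintegralZl _ _ iux); last exact: measurable_itv.
by move=> /eqP; rewrite subr_eq0 => /eqP.
Qed.

Let bounded_near r0 : exists M : R, forall r t, r \in `]r0 - 1, r0 + 1[ ->
  `|ux (circle r t)| <= M.
Proof.
pose B : R := `|r0| + 1.
pose K : set (R * R) := (`[z0.1 - B, z0.1 + B] `*` `[z0.2 - B, z0.2 + B])%classic.
have cK : compact K by apply: compact_setX; exact: segment_compact.
have cuK : {within K, continuous ux} by apply: continuous_subspaceT.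
have [M [_ HM]] := compact_bounded (continuous_compact cuK cK).
exists (M + 1) => r t; rewrite in_itv /= => /andP[r1 r2].
apply: (HM (M + 1)); first by rewrite ltrDl.
exists (circle r t) => //.
have rB : `|r| <= B.
  by rewrite /B ler_norml; have := ler_norm r0; have := ler_norm (- r0); rewrite normrN; lra.
have h (x : R) : `|x| <= 1 -> `|r * x| <= B.
  by move=> x1; rewrite normrM -[B]mulr1 ler_pM.
have hc : `|cos t| <= 1 by rewrite ler_norml cos_geN1 cos_le1.
have hs : `|sin t| <= 1 by rewrite ler_norml sin_geN1 sin_le1.
have := h _ hc; have := h _ hs; rewrite !ler_norml => hs' hc'.
by split; rewrite /= in_itv /=; move: hs' hc' => /andP[? ?] /andP[? ?]; lra.
Qed.

Let dn r : is_derive r (1 : R) n (m r).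
Proof.
have [M HM] := bounded_near r.
have d1E : forall r t, (partial1of2 f) r t = ux (circle r t).
  by move=> s t; rewrite partial1of2E; have := df_r s t => h; rewrite derive_val.
have l : h^-1 *: (n (h + r) - n r) @[h --> 0^'] --> m r.
  have -> : m r = (\int[mu]_(t in I) (partial1of2 f) r t)%R.
    by apply: eq_Rintegral => t _; rewrite d1E.
  apply: (@cvg_differentiation_under_integral R _ _ mu f I _ r (r - 1) (r + 1) _ _ _ (fun=> `|M|)).
  - exact: measurable_itv.
  - by rewrite /= in_itv /=; apply/andP; split; lra.
  - by move=> s _; apply: integrable_continuous; exact: cf.
  - by move=> s t _ _; have [] := df_r s t.
  - by [].
  - by apply: integrable_continuous; exact: cst_continuous.
  - move=> s t hs _; rewrite d1E; apply: le_trans (HM _ _ hs) _.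
    exact: ler_norm.
apply: DeriveDef.
  apply/cvg_ex; exists (m r); move: l; apply: cvg_trans.
  by apply: near_eq_cvg; near=> h; rewrite /= [h *: 1]mulr1.
apply: cvg_lim => //; move: l; apply: cvg_trans.
by apply: near_eq_cvg; near=> h; rewrite /= [h *: 1]mulr1.
Unshelve. all: by end_near.
Qed.

(** By nE and dn, r n'(r) = n(r), so m(r) = n(r) / r has derivative zero; the
    substitution r = exp(s) makes the domain the whole line. *)
Let m_cst r : 0 < r -> m r = m 1.
Proof.
move=> r0; rewrite -[r in LHS]lnK ?posrE // -[1 in RHS]expR0.
have mE s : m (expR s) = n (expR s) * expR (- s).
  by rewrite nE mulrAC -expRD subrr expR0 mul1r.
apply: (is_derive_0_is_cst (f := fun s => m (expR s))) => s.
have -> : (fun s => m (expR s)) = fun s => n (expR s) * expR (- s).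
  by apply/funext => x; rewrite mE.
have dne : is_derive s (1 : R) (fun s => n (expR s)) (m (expR s) * expR s).
  exact: (@is_derive1_comp _ n expR).
apply: is_derive_eq; rewrite /GRing.scale /= nE.
by rewrite mulrN1; ring.
Qed.

(** Since n(r) = r m(1) is bounded for r > 0, m(1) = 0 and n vanishes on the
    positive half-line; so does its derivative at 0, which is 2 pi ux(z0). *)
Lemma liouville_partial_eq0 (B : R) :
  (forall z, `|u z| <= B) -> (forall z, `|v z| <= B) -> ux z0 = 0.
Proof.
move=> hu hv.
have mI : lebesgue_measure I = (2 * pi)%:E :> \bar R.
  by rewrite /I lebesgue_measure_itv /= lte_fin pi2 oppr0 adde0.
have cstI (a : R) : (\int[mu]_(t in I) a = a * (2 * pi))%R.
  rewrite Rintegral_cst; last exact: measurable_itv.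
  by transitivity (a * fine (lebesgue_measure I)); [|rewrite mI].
have nB r : `|n r| <= 2 * B * (2 * pi).
  have if_ := integrable_continuous (@cf r).
  apply: le_trans (le_normr_Rintegral _ if_) _; first exact: measurable_itv.
  rewrite -cstI; apply: le_Rintegral.
  - exact: measurable_itv.
  - apply: integrable_continuous => t.
    by apply: (@continuous_comp _ _ _ (f r) Num.norm); [exact: cf|exact: norm_continuous].
  - by apply: integrable_continuous; exact: cst_continuous.
  - move=> t _; apply: le_trans (ler_normD _ _) _; rewrite !normrM mulr_natl mulr2n.
    have B0 : 0 <= B by exact: le_trans (hu 0).
    apply: lerD; rewrite -[B]mulr1; apply: ler_pM => //.
      by rewrite ler_norml cos_geN1 cos_le1.
    by rewrite ler_norml sin_geN1 sin_le1.
have m1 : m 1 = 0.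
  apply/eqP; apply/negPn/negP => m10.
  have B0 : 0 <= 2 * B * (2 * pi) by exact: le_trans (nB 0).
  set C := 2 * B * _ in nB B0.
  have m1p : 0 < `|m 1| by rewrite normr_gt0.
  pose r := (C + 1) / `|m 1|.
  have r0 : 0 < r by rewrite divr_gt0 // ltr_wpDl.
  have := nB r; rewrite nE m_cst // normrM (ger0_norm (ltW r0)) /r.
  by rewrite divfK ?gt_eqF //; lra.
have n0 r : 0 <= r -> n r = 0.
  by rewrite le_eqVlt nE => /orP[/eqP <-|/m_cst ->]; rewrite ?mul0r // m1 mulr0.
have m0 : m 0 = 0.
  have [g [gE cg g0]] := (is_derive1_caratheodory n 0 (m 0)).1 (dn 0).
  rewrite -g0; apply/eqP; apply/negPn/negP => gn0.
  move/cvgrPdist_lt : cg => /(_ `|g 0|); rewrite normr_gt0 => /(_ gn0).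
  move=> /nbhs_ballP[e /= e0 he].
  have : ball (0 : R) e (e / 2).
    by rewrite /ball /= sub0r normrN ger0_norm ?divr_ge0 1?ltW //; lra.
  move=> /he; have := gE (e / 2).
  rewrite !n0 ?lexx ?divr_ge0 // 1?ltW // subrr subr0 => /esym/eqP.
  rewrite mulf_eq0 [e / 2 == 0]gt_eqF ?divr_gt0 // orbF => /eqP ->.
  by rewrite subr0 ltxx.
move: m0; rewrite /m (_ : (fun t => ux (circle 0 t)) = fun=> ux z0).
  by rewrite cstI => /eqP; rewrite mulf_eq0 (gt_eqF pi2) orbF => /eqP.
by apply/funext => t; rewrite /circle !mul0r !addr0 -surjective_pairing.
Qed.

End Liouville.

(** * Liouville's theorem on slices *)

Section SliceLiouville.
Variable R : realType.
Implicit Types (q w I : quat R).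

Lemma continuous_qdot w : continuous (fun q : quat R => qdot q w).
Proof.
move=> q.
have c (i : 'I_4) : {for q, continuous (fun x : quat R => x 0 i * w 0 i)}.
  by apply: continuousM; [exact: continuous_coord|exact: cst_continuous].
have -> : (fun q => qdot q w) = fun x : quat R => x 0 0 * w 0 0 + x 0 1 * w 0 1
    + x 0 2 * w 0 2 + x 0 3 * w 0 3 by apply/funext => x; rewrite qdotE.
exact: continuousD (continuousD (continuousD (c 0) (c 1)) (c 2)) (c 3).
Qed.

Lemma is_derive_qdot (G : R * R -> quat R) (z v : R * R) (d w : quat R) :
  is_derive z v G d -> is_derive z v (fun x => qdot (G x) w) (qdot d w).
Proof.
move=> [dG dE].
have l : h^-1 *: (((fun x => qdot (G x) w) \o shift z) (h *: v) - qdot (G z) w)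
    @[h --> 0^'] --> qdot d w.
  have -> : (fun h : R => h^-1 *: (((fun x => qdot (G x) w) \o shift z) (h *: v)
      - qdot (G z) w)) =
    (fun q => qdot q w) \o (fun h : R => h^-1 *: ((G \o shift z) (h *: v) - G z)).
    apply/funext => h /=; rewrite /GRing.scale /= !qdotE !quatE; ring.
  apply: continuous_cvg; first exact: continuous_qdot.
  by rewrite -dE; exact: dG.
by apply: DeriveDef; [apply/cvg_ex; eexists; exact: l|exact: cvg_lim l].
Qed.

Lemma qdot_norm_le q w : `|qdot q w| <= 4 * (`|q| * `|w|).
Proof.
have c i : `|q 0 i * w 0 i| <= `|q| * `|w|.
  by rewrite normrM ler_pM // norm_coord_le.
rewrite qdotE.
have := c 0; have := c 1; have := c 2; have := c 3.
by rewrite !ler_norml => /andP[? ?] /andP[? ?] /andP[? ?] /andP[? ?]; apply/andP; split; lra.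
Qed.

(** Pairing with w and I w splits a function that is holomorphic for left
    multiplication by I into Cauchy-Riemann pairs. *)
Lemma slice_liouville I (G Gx Gy : R * R -> quat R) (B : R) : imag_units I ->
  (forall z, is_derive (z : R * R) ((1, 0) : R * R) G (Gx z)) ->
  (forall z, is_derive (z : R * R) ((0, 1) : R * R) G (Gy z)) ->
  continuous Gx -> continuous Gy -> (forall z, Gx z + I * Gy z = 0) ->
  (forall z, `|G z| <= B) -> forall z, G z = G (0, 0).
Proof.
move=> uI dx dy cx cy CR GB z.
have [I0 _] := (imag_unitsP I).1 uI.
have GxE x : Gx x = - (I * Gy x) by apply/eqP; rewrite -addr_eq0 CR.
have II : I * I = -1 by rewrite -expr2.
have key w : (forall x, qdot (Gx x) w = 0) /\ (forall x, qdot (Gy x) w = 0).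
  have skew p q : qdot (I * p) q = - qdot p (I * q).
    by rewrite !qdotE !quatE I0; ring.
  have duy x := is_derive_qdot w (dy x).
  have dux x := is_derive_qdot w (dx x).
  have dvx x : is_derive (x : R * R) ((1, 0) : R * R)
      (fun x => qdot (G x) (I * w)) (- qdot (Gy x) w).
    rewrite (_ : - qdot (Gy x) w = qdot (Gx x) (I * w)); first exact: is_derive_qdot.
    by rewrite GxE -[- (I * _)]mulrN skew mulrA II mulN1r !qdotE !quatE; ring.
  have dvy x : is_derive (x : R * R) ((0, 1) : R * R)
      (fun x => qdot (G x) (I * w)) (qdot (Gx x) w).
    rewrite (_ : qdot (Gx x) w = qdot (Gy x) (I * w)); first exact: is_derive_qdot.
    by rewrite GxE -[- (I * _)]mulrN skew !qdotE !quatE; ring.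
  have cq (H : R * R -> quat R) y : continuous H -> continuous (fun x => qdot (H x) y).
    move=> cH x; apply: (@continuous_comp _ _ _ H (fun q => qdot q y)); first exact: cH.
    exact: continuous_qdot.
  have bd y x : `|qdot (G x) y| <= 4 * (B * `|y|).
    apply: le_trans (qdot_norm_le _ _) _.
    by rewrite ler_wpM2l // ler_wpM2r.
  pose C := Num.max (4 * (B * `|w|)) (4 * (B * `|I * w|)).
  have bu x : `|qdot (G x) w| <= C by rewrite le_max bd.
  have bv x : `|qdot (G x) (I * w)| <= C by rewrite le_max bd orbT.
  split=> x.
    exact: (liouville_partial_eq0 dux duy dvx dvy (cq _ _ cx) (cq _ _ cy) _ bu bv).
  have cN (g : R * R -> R) : continuous g -> continuous (fun x => - g x).
    by move=> cg t; apply: continuousN; exact: cg.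
  have dNx t : is_derive (t : R * R) ((1, 0) : R * R)
      (fun x => - qdot (G x) w) (- qdot (Gx t) w) by exact: is_deriveN.
  have dNy t : is_derive (t : R * R) ((0, 1) : R * R)
      (fun x => - qdot (G x) w) (- qdot (Gy t) w) by exact: is_deriveN.
  have bN t : `|- qdot (G t) w| <= C by rewrite normrN.
  apply/eqP; rewrite -oppr_eq0; apply/eqP.
  exact: (liouville_partial_eq0 dvx dvy dNx dNy (cN _ (cq _ _ cy)) (cq _ _ cx) _ bv bN).
have [dxw dyw] := key (G z - G (0, 0)).
apply/eqP; rewrite -subr_eq0 -qdot_eq0; apply/eqP.
set w := G z - G (0, 0) in dxw dyw *.
have e : qdot (G z) w = qdot (G (0, 0)) w.
  transitivity (qdot (G (0, z.2)) w).
    rewrite [in LHS](surjective_pairing z).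
    apply: (is_derive_0_is_cst (f := fun s => qdot (G (s, z.2)) w)) => s.
    have := partial_fst (is_derive_qdot w (dx (s, z.2))).
    by rewrite dxw.
  apply: (is_derive_0_is_cst (f := fun s => qdot (G (0, s)) w)) => s.
  have := partial_snd (is_derive_qdot w (dy (0, s))).
  by rewrite dyw.
have -> : qdot w w = qdot (G z) w - qdot (G (0, 0)) w.
  by rewrite {1}/w qdotBl.
by rewrite e subrr.
Qed.

End SliceLiouville.

(** * Balls, slices and fundamental domains *)

Section BallCharts.
Variable R : realType.
Implicit Types (p q w x a I : quat R) (L : lattice R).

Lemma qballP q (r : R) p : ball q r p <-> `|p - q| < r.
Proof. by rewrite -ball_normE /ball_ /= distrC. Qed.

Lemma connected_ball q (r : R) : connected (ball q r).
Proof.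
have [r0|r0] := ltP 0 r; last first.
  rewrite (_ : ball q r = set0); first exact: connected0.
  rewrite -subset0 => p /qballP h.
  by have := le_lt_trans (normr_ge0 _) h; rewrite ltNge r0.
pose seg p : set (quat R) := (fun t : R => q + t *: (p - q)) @` `[0, 1].
have -> : ball q r = \bigcup_(p in ball q r) seg p.
  apply/seteqP; split=> [p pq|_ [p /qballP pq [t /= t01 <-]]].
    exists p => //; exists 1; first by rewrite /= in_itv /= ler01 lexx.
    by rewrite scale1r addrC subrK.
  apply/qballP; rewrite addrAC subrr add0r normrZ.
  move: t01; rewrite in_itv /= => /andP[t0 t1].
  rewrite (ger0_norm t0); apply: le_lt_trans pq.
  by rewrite -[leRHS]mul1r ler_wpM2r.
apply: bigcup_connected.
  exists q => p _; exists 0; first by rewrite /= in_itv /= ler01 lexx.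
  by rewrite scale0r addr0.
move=> p _; apply: connected_continuous_connected; first exact: segment_connected.
apply: continuous_subspaceT => t.
have c : {for t, continuous (fun s : R => s *: (p - q))}.
  by apply: continuousZr_tmp; exact: cvg_id.
have cq : {for t, continuous (fun _ : R => q)} by exact: cst_continuous.
exact: (continuousD cq c).
Qed.

Lemma ball_chart_dom L : exists2 r : R, 0 < r &
  forall q s, 0 < s -> s <= r -> chart_dom L (ball q s).
Proof.
have [rho rho0 gap] := lattice_gap L.
exists (rho / 2); first by rewrite divr_gt0.
move=> q s s0 sr; split; [exact: ball_open|exact: connected_ball|].
move=> x y; rewrite !inE => /qballP xq /qballP yq /proj_eq Lxy.
apply/eqP; rewrite -subr_eq0; apply/eqP/gap => //.
have -> : x - y = (x - q) - (y - q) by rewrite opprB addrA subrK.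
by apply: le_lt_trans (ler_normB _ _) _; move: xq yq sr; lra.
Qed.

Lemma slice_cover q : exists2 I, imag_units I & exists z, slice_point I z = q.
Proof.
pose p : quat R := mkquat 0 (q 0 1) (q 0 2) (q 0 3).
have [p0|p0] := eqVneq p 0.
  exists (qi R); first by apply/imag_unitsP; rewrite qdotE !quatE; split=> //; ring.
  exists (q 0 0, 0); apply: quatP; rewrite /slice_point !quatE /= ?mulr0 ?mulr1 ?addr0 //.
  - by have := congr1 (fun x : quat R => x 0 1) p0; rewrite !quatE => ->.
  - by have := congr1 (fun x : quat R => x 0 2) p0; rewrite !quatE => ->.
  - by have := congr1 (fun x : quat R => x 0 3) p0; rewrite !quatE => ->.
pose n := qnorm p.
have n2 : n ^+ 2 = qdot p p by rewrite /n /qnorm sqr_sqrtr ?qdot_ge0.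
have n0 : n != 0 by rewrite -sqrf_eq0 n2 qdot_eq0.
exists (n^-1 *: p).
  apply/imag_unitsP; split; first by rewrite !quatE mulr0.
  have -> : qdot (n^-1 *: p) (n^-1 *: p) = n^-1 ^+ 2 * qdot p p.
    by rewrite !qdotE !quatE; ring.
  by rewrite -n2 -exprMn mulVf // expr1n.
exists (q 0 0, n); rewrite /slice_point /= scalerA divff // scale1r.
by apply: quatP; rewrite !quatE; ring.
Qed.

Lemma norm_le_coord q (c : R) : 0 <= c -> (forall i, `|q 0 i| <= c) -> `|q| <= c.
Proof.
move=> c0 h; rewrite [leLHS]/Num.norm /= mx_normrE.
by apply/bigmax_leP; split => // -[i j] _ /=; rewrite (ord1 i).
Qed.

Lemma slice_point_norm I (y z : R * R) : imag_units I ->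
  `|y.1| <= `|z.1| -> `|y.2| <= `|z.2| ->
  `|slice_point I y| <= `|slice_point I z|.
Proof.
move=> /imag_unitsP[I0 _] y1 y2.
have one0 (i : 'I_4) : i != 0 -> (1 : quat R) 0 i = 0.
  case: i => [[|[|[|[|//]]]] i4] // _.
  - by rewrite (_ : Ordinal i4 = 1) ?quatE //; apply/val_inj.
  - by rewrite (_ : Ordinal i4 = 2) ?quatE //; apply/val_inj.
  - by rewrite (_ : Ordinal i4 = 3) ?quatE //; apply/val_inj.
apply: norm_le_coord => // i; apply: le_trans (norm_coord_le _ i).
rewrite /slice_point !quatD !quatZ; have [->|i0] := eqVneq i 0.
  by rewrite I0 !mulr0 !addr0 !quat1E !mulr1.
by rewrite one0 // !mulr0 !add0r !normrM ler_wpM2r.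
Qed.

Lemma lattice_fundamental L : exists M : R, forall q,
  exists2 p, `|p| <= M & lattice_set L (q - p).
Proof.
have [v fv LE] := latticeP L.
exists (\sum_i `|tnth v i|) => q.
pose c i := coord v i q.
exists (\sum_i (c i - (Num.floor (c i))%:~R) *: tnth v i).
  apply: le_trans (ler_norm_sum _ _ _) _; apply: ler_sum => i _.
  rewrite normrZ ger0_norm ?subr_ge0 ?floor_le // -[leRHS]mul1r ler_wpM2r //.
  by have := floorD1_gt (c i); rewrite intrD; lra.
rewrite LE; exists (fun i => Num.floor (c i)).
rewrite ZspanE {1}(free4_coord fv q) -sumrB; apply: eq_bigr => i _.
by rewrite -scalerBl opprB addrC subrK.
Qed.

End BallCharts.

(** * Uniform local lifts of a regular map *)

Section LocalLifts.
Variable R : realType.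
Implicit Types (p q w x a I : quat R).

Variables (L1 L2 : lattice R) (F : torus L1 -> torus L2).
Hypothesis rF : regular_map F.
Let g q := F (Defs.proj L1 q).

Let g_periodic q x : lattice_set L1 x -> g (q + x) = g q.
Proof. by move=> Lx; rewrite /g projD. Qed.

(** The openness of the domains in the definition of a regular map makes F
    continuous, which gives lifts on small balls; the radius can be chosen
    uniformly because F o pi is periodic and a fundamental domain is
    relatively compact. *)
Lemma local_lifts (e : R) : 0 < e -> exists2 d : R, 0 < d &
  forall q0, exists f : quat R -> quat R,
    [/\ slice_regular (ball q0 d) f,
        forall q, ball q0 d q -> Defs.proj L2 (f q) = g q &
        forall p q, ball q0 d p -> ball q0 d q -> `|f p - f q| < e].
Proof.
move=> e0.
have [r1 r10 chart1] := ball_chart_dom L1.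
have [r2 r20 chart2] := ball_chart_dom L2.
pose s := Num.min r2 (e / 2).
have s0 : 0 < s by rewrite lt_min r20 divr_gt0.
have chartV w : chart_dom L2 (ball w s) by apply: chart2 => //; rewrite ge_min lexx.
pose P (d : R) q := exists w, forall q', ball q d q' -> (Defs.proj L2 @` ball w s) (g q').
have Ploc q : exists2 d, 0 < d & P d q.
  have [w wq] := proj_surj (g q).
  have [oO _] := rF (chart1 q r1 r10 (lexx _)) (chartV w).
  have /nbhs_ballP[d /= d0 dO] : nbhs q (ball q r1 `&`
      [set q0 | [set Defs.proj L2 x | x in ball w s] (F (Defs.proj L1 q0))]).
    apply: open_nbhs_nbhs; split=> //; split; first exact: ballxx.
    by exists w => //; exact: ballxx.
  by exists d => //; exists w => q' /dO[].
have Ptrans d q x : lattice_set L1 x -> P d q -> P d (q + x).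
  move=> Lx [w h]; exists w => q' /qballP hq.
  have := g_periodic (q' - x) Lx; rewrite subrK => ->.
  by apply: h; apply/qballP; rewrite addrAC -addrA -opprD.
have [M hM] := lattice_fundamental L1.
pose K : set (quat R) := [set q | `|q| <= M].
have cK : compact K.
  apply: (@bounded_closed_compact R 4 K).
    exists M; split; first exact: num_real.
    by move=> x Mx q /= h; exact: le_trans h (ltW Mx).
  have cn : continuous (fun q : quat R => `|q|) by exact: norm_continuous.
  exact: (preimage_closed (fun x _ => cn x) (@closed_le R M)).
have [d1 d10 hd1] : exists2 d, 0 < d & K `<=` P d.
  have /compact_near_coveringP/(_ R (0 : R)^'+ P _) near_P := cK.
  have {}near_P : \forall d \near (0 : R)^'+, K `<=` P d.
    apply: near_P => x _; have [eta eta0 [w hw]] := Ploc x.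
    have e2 : 0 < eta / 2 by rewrite divr_gt0.
    exists (ball x (eta / 2), [set i : R | i < eta / 2]) => /=.
      by split; [exact: nbhsx_ballx|exact: nbhs_right_lt].
    move=> [x' i] /= [/qballP hx hi]; exists w => q' /qballP hq'.
    apply: hw; apply/qballP.
    have -> : q' - x = (q' - x') + (x' - x) by rewrite addrA subrK.
    by apply: le_lt_trans (ler_normD _ _) _; move: hx hq' hi; lra.
  near (0 : R)^'+ => d; exists d; first by near: d; exact: nbhs_right_gt.
  by near: d.
pose d := Num.min r1 d1.
have d0 : 0 < d by rewrite lt_min r10.
exists d => // q0.
have [w hw] : P d1 q0.
  have [p pM Lp] := hM q0.
  by rewrite -(subrK p q0) addrC; apply: Ptrans => //; exact: hd1.
have wd q : ball q0 d q -> (Defs.proj L2 @` ball w s) (g q).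
  by move=> /qballP h; apply: hw; apply/qballP; apply: lt_le_trans h _; rewrite ge_min lexx orbT.
exists (fun q => chart (ball w s) (g q)); split.
- have := rF (chart1 q0 d d0 _) (chartV w).
  rewrite [ball q0 d `&` _](_ : _ = ball q0 d).
    by apply; rewrite ge_min lexx.
  by apply/seteqP; split=> [q []//|q hq]; split=> //; exact: wd.
- by move=> q /wd[v vw <-]; rewrite chartK.
- move=> p q /wd[u uw <-] /wd[v vw <-]; rewrite !chartK //.
  move: uw vw => /qballP uw /qballP vw.
  have -> : u - v = (u - w) - (v - w) by rewrite opprB addrA subrK.
  apply: le_lt_trans (ler_normB _ _) _.
  have : s <= e / 2 by rewrite ge_min lexx orbT.
  by move: uw vw; lra.
Unshelve. all: by end_near.
Qed.

End LocalLifts.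

(** * Local lifts are affine *)

Section SmallSteps.
Variable R : realType.
Implicit Types (p q w x a I : quat R).

Lemma slice_regular_partials Om (f : quat R -> quat R) I :
  slice_regular Om f -> imag_units I -> exists fx fy : R * R -> quat R,
    forall z, Om (slice_point I z) ->
    [/\ is_derive z ((1, 0) : R * R) (f \o slice_point I) (fx z),
        is_derive z ((0, 1) : R * R) (f \o slice_point I) (fy z),
        {for z, continuous fx}, {for z, continuous fy} & fx z + I * fy z = 0].
Proof.
move=> [oO reg] uI; have [dv cx cy CR] := reg I uI.
have oI : open (slice_point I @^-1` Om).
  by apply: open_comp => // z _; exact: continuous_slice_point.
have cO (k : R * R -> quat R) : {within slice_point I @^-1` Om, continuous k} ->
    forall z, Om (slice_point I z) -> {for z, continuous k}.
  move=> /subspace_continuousP ck z Oz U /(ck z Oz) kU.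
  have nO : \forall y \near z, Om (slice_point I y).
    by apply: open_nbhs_nbhs; split.
  by apply: filterS2 nO kU => y Oy /(_ Oy).
exists (fun z => 'D_(1, 0) (f \o slice_point I) z),
  (fun z => 'D_(0, 1) (f \o slice_point I) z) => z Oz.
have [d1 d2] := dv z Oz.
split.
- by constructor; [exact: d1|].
- by constructor; [exact: d2|].
- exact: cO cx z Oz.
- exact: cO cy z Oz.
- have := congr1 (fun x => 2%:R *: x) (CR z Oz).
  by rewrite scalerA divff // scale1r scaler0.
Qed.

Lemma norm_quat1 : `|1 : quat R| = 1.
Proof.
apply/le_anti/andP; split.
  by rewrite -(@ler_pXn2r _ 2) ?nnegrE // expr1n -qdot1 norm_sqr_le.
by have := norm_coord_le (1 : quat R) 0; rewrite quat1E normr1.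
Qed.

Lemma slice_pointD I z y : slice_point I (z + y) = slice_point I z + slice_point I y.
Proof. by rewrite /slice_point /= !scalerDl addrACA. Qed.

Lemma slice_point_fst I (h : R) : slice_point I (h, 0) = h *: (1 : quat R).
Proof. by rewrite /slice_point /= scale0r addr0. Qed.

Lemma is_derive_translate (f : R * R -> quat R) (c z v : R * R) d :
  is_derive (z + c) v f d -> is_derive z v (fun y => f (y + c)) d.
Proof.
move=> [df <-].
have E : (fun h : R => h^-1 *: (((fun y => f (y + c)) \o shift z) (h *: v) - f (z + c)))
    = (fun h : R => h^-1 *: ((f \o shift (z + c)) (h *: v) - f (z + c))).
  by apply/funext => h /=; rewrite addrA.
by apply: DeriveDef; [rewrite /derivable E|rewrite /derive E].
Qed.

Variables (L1 L2 : lattice R) (F : torus L1 -> torus L2).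
Let g q := F (Defs.proj L1 q).

Variables (rho d : R).
Hypotheses (d0 : 0 < d).
Hypothesis gap : forall x, lattice_set L2 x -> `|x| < rho -> x = 0.

Definition local_lift (q0 : quat R) (f : quat R -> quat R) :=
  [/\ slice_regular (ball q0 d) f,
      forall q, ball q0 d q -> Defs.proj L2 (f q) = g q &
      forall p q, ball q0 d p -> ball q0 d q -> `|f p - f q| < rho / 2].

Hypothesis lifts : forall q0, exists f, local_lift q0 f.

(** The difference f(q + h) - f(q) for every local lift f of F near q: as it is
    shorter than rho / 2, it does not depend on the lift. *)
Definition small_step (h : R) q u := `|u| < rho / 2 /\
  exists2 w, Defs.proj L2 w = g q & Defs.proj L2 (w + u) = g (q + h *: (1 : quat R)).

Lemma small_step_uniq h q u u' : small_step h q u -> small_step h q u' -> u = u'.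
Proof.
move=> [us [w wq wu]] [us' [w' wq' wu']].
apply/eqP; rewrite -subr_eq0; apply/eqP/gap; last first.
  by apply: le_lt_trans (ler_normB _ _) _; move: us us'; lra.
have /proj_eq a1 : Defs.proj L2 w = Defs.proj L2 w' by rewrite wq.
have /proj_eq a2 : Defs.proj L2 (w + u) = Defs.proj L2 (w' + u') by rewrite wu.
have -> : u - u' = (w + u - (w' + u')) - (w - w').
  by apply: quatP; rewrite !quatE; ring.
exact: latticeB.
Qed.

Lemma small_step_lift h q0 f q : local_lift q0 f ->
  ball q0 d q -> ball q0 d (q + h *: (1 : quat R)) ->
  small_step h q (f (q + h *: (1 : quat R)) - f q).
Proof.
move=> [_ pf of_] bq bq'; split; first exact: of_.
by exists (f q); [exact: pf|rewrite addrC subrK pf].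
Qed.

Lemma small_step_ex h q : `|h| < d -> exists u, small_step h q u.
Proof.
move=> hd; have [f lf] := lifts q.
exists (f (q + h *: (1 : quat R)) - f q); apply: (small_step_lift lf); first exact: ballxx.
by apply/qballP; rewrite addrAC subrr add0r normrZ norm_quat1 mulr1.
Qed.

(** The step u(q) = f(q + h) - f(q) is defined for all q although the lift f is
    only local. It is bounded and holomorphic on each slice, hence constant on
    each slice, and all slices contain the origin. *)
Lemma small_step_const h : `|h| < d / 2 -> exists c, forall q, small_step h q c.
Proof.
move=> hd.
have hd' : `|h| < d by apply: lt_trans hd _; rewrite ltr_pdivrMr // ltr_pMr // ltr1n.
have [D hD] := choice (fun q => small_step_ex q hd').
suff Dc I : imag_units I -> forall z, D (slice_point I z) = D 0.
  exists (D 0) => q; have [I uI [z <-]] := slice_cover q.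
  by rewrite -(Dc I uI z).
move=> uI; pose G := D \o slice_point I; pose c0 : R * R := (h, 0).
have loc z0 : exists fx fy : R * R -> quat R,
  (\forall z \near z0, is_derive z ((1, 0) : R * R) G (fx z) /\
     is_derive z ((0, 1) : R * R) G (fy z)) /\
  [/\ {for z0, continuous fx}, {for z0, continuous fy} & fx z0 + I * fy z0 = 0].
  have [f lf] := lifts (slice_point I z0).
  have [reg pf of_] := lf.
  have [fx [fy hf]] := slice_regular_partials reg uI.
  have nr : \forall z \near z0, ball (slice_point I z0) d (slice_point I z) /\
      ball (slice_point I z0) d (slice_point I (z + c0)).
    have : \forall z \near z0, ball (slice_point I z0) (d / 2) (slice_point I z).
      apply: (@continuous_slice_point R I z0).
      by apply: nbhsx_ballx; rewrite divr_gt0.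
    apply: filterS => z /qballP hz; split; apply/qballP.
      by apply: lt_trans hz _; rewrite ltr_pdivrMr // ltr_pMr // ltr1n.
    rewrite slice_pointD slice_point_fst addrAC.
    apply: le_lt_trans (ler_normD _ _) _; rewrite normrZ norm_quat1 mulr1.
    by move: hz hd; lra.
  have GE z : ball (slice_point I z0) d (slice_point I z) ->
      ball (slice_point I z0) d (slice_point I (z + c0)) ->
      G z = f (slice_point I (z + c0)) - f (slice_point I z).
    move=> b1 b2; rewrite slice_pointD slice_point_fst in b2 *.
    exact: small_step_uniq (hD _) (small_step_lift lf b1 b2).
  have [b1 b2] := nbhs_singleton nr.
  exists (fun z : R * R => fx (z + c0) - fx z), (fun z : R * R => fy (z + c0) - fy z); split.
    have nG := near_join nr.
    apply: filterS nG => z nz; have [bz bz'] := nbhs_singleton nz.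
    have nE : \forall y \near z,
        ((f \o slice_point I) (y + c0) - (f \o slice_point I) y) = G y.
      by apply: filterS nz => y [? ?]; rewrite GE.
    have [dx dy _ _ _] := hf _ bz; have [dx' dy' _ _ _] := hf _ bz'.
    have tx := is_derive_translate dx'; have ty := is_derive_translate dy'.
    split; apply: near_eq_is_derive nE _; exact: is_deriveB.
  have [_ _ cx cy e] := hf _ b1; have [_ _ cx' cy' e'] := hf _ b2.
  have tr (k : R * R -> quat R) : {for z0 + c0, continuous k} ->
      {for z0, continuous (fun z : R * R => k (z + c0))}.
    move=> ck; apply: (@continuous_comp _ _ _ (fun z : R * R => z + c0) k) => //.
    have ci : {for z0, continuous (fun z : R * R => z)} by exact: cvg_id.
    have cc : {for z0, continuous (fun _ : R * R => c0)} by exact: cst_continuous.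
    exact: (continuousD ci cc).
  split.
  - exact: (continuousB (tr _ cx') cx).
  - exact: (continuousB (tr _ cy') cy).
  - by rewrite mulrBr addrACA -opprD e e' subrr.
pose Gx z := 'D_((1, 0) : R * R) G z; pose Gy z := 'D_((0, 1) : R * R) G z.
have Geq z0 : exists fx fy : R * R -> quat R, [/\ \forall z \near z0, Gx z = fx z,
    \forall z \near z0, Gy z = fy z, {for z0, continuous fx},
    {for z0, continuous fy} & fx z0 + I * fy z0 = 0].
  have [fx [fy [nd [cx cy e]]]] := loc z0; exists fx, fy; split => //.
    by apply: filterS nd => z [h1 _]; rewrite /Gx derive_val.
  by apply: filterS nd => z [_ h1]; rewrite /Gy derive_val.
have cont (k l : R * R -> quat R) z0 : (\forall z \near z0, k z = l z) ->
    {for z0, continuous l} -> {for z0, continuous k}.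
  move=> n cl; have e := nbhs_singleton n.
  rewrite /prop_for /continuous_at e; apply: cvg_trans cl.
  by apply: near_eq_cvg; apply: filterS n => z ->.
suff GG z : G z = G (0, 0).
  by move=> z; rewrite [LHS](GG z) /G /= slice_point_fst scale0r.
apply: (@slice_liouville R I G Gx Gy (rho / 2)) => //.
- move=> y; have [fx [fy [nd _]]] := loc y.
  by have [[dG _] _] := nbhs_singleton nd; constructor.
- move=> y; have [fx [fy [nd _]]] := loc y.
  by have [_ [dG _]] := nbhs_singleton nd; constructor.
- by move=> y; have [fx [fy [n1 _ c1 _ _]]] := Geq y; exact: cont n1 c1.
- by move=> y; have [fx [fy [_ n1 _ c1 _]]] := Geq y; exact: cont n1 c1.
- move=> y; have [fx [fy [n1 n2 _ _ e]]] := Geq y.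
  by rewrite (nbhs_singleton n1) (nbhs_singleton n2).
- by move=> y; have [/ltW] := hD (slice_point I y).
Qed.

(** On every slice, the real derivative of a local lift is the limit of c(h) / h,
    where the constant step c(h) depends neither on the lift nor on the slice;
    the other derivative follows from the Cauchy-Riemann equation. *)
Lemma small_step_slope : exists a, forall q0 f I z, local_lift q0 f ->
  imag_units I -> ball q0 d (slice_point I z) ->
  is_derive z ((1, 0) : R * R) (f \o slice_point I) a /\
  is_derive z ((0, 1) : R * R) (f \o slice_point I) (I * a).
Proof.
have d2 : 0 < d / 2 by rewrite divr_gt0.
have /choice[c hc] : forall h, exists c, `|h| < d / 2 -> forall q, small_step h q c.
  move=> h; have [hd|hd] := ltP `|h| (d / 2); last by exists 0.
  by have [c hc] := small_step_const hd; exists c.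
exists (lim (h^-1 *: c h @[h --> (0 : R)^'])) => q0 f I z lf uI bz.
have [reg _ _] := lf.
have [fx [fy hf]] := slice_regular_partials reg uI.
have [dx dy _ _ e] := hf z bz.
suff -> : lim (h^-1 *: c h @[h --> (0 : R)^']) = fx z.
  split=> //; rewrite (_ : I * fx z = fy z) //.
  have -> : fx z = - (I * fy z) by apply/eqP; rewrite -addr_eq0 e.
  by rewrite mulrN mulrA -expr2 uI mulN1r opprK.
apply: cvg_lim => //; have [ddx <-] := dx.
apply: cvg_trans ddx; apply: near_eq_cvg.
have nb : \forall h \near (0 : R)^', ball q0 d (slice_point I (h *: ((1, 0) : R * R) + z)).
  have eta0 : 0 < d - `|slice_point I z - q0| by move: bz => /qballP; rewrite subr_gt0.
  near=> h; apply/qballP; rewrite slice_pointD.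
  have -> : h *: ((1, 0) : R * R) = (h, 0).
    by congr (_, _); [exact: mulr1|exact: mulr0].
  rewrite slice_point_fst -addrA.
  apply: le_lt_trans (ler_normD _ _) _; rewrite normrZ norm_quat1 mulr1.
  rewrite -ltrBrDr; near: h; exact: dnbhs0_lt.
near=> h.
have hd : `|h| < d / 2 by near: h; exact: dnbhs0_lt.
have bh : ball q0 d (slice_point I (h *: ((1, 0) : R * R) + z)) by near: h.
have sE : slice_point I (h *: ((1, 0) : R * R) + z) = slice_point I z + h *: (1 : quat R).
  have -> : h *: ((1, 0) : R * R) = (h, 0).
    by congr (_, _); [exact: mulr1|exact: mulr0].
  by rewrite slice_pointD slice_point_fst addrC.
rewrite /= sE; congr (_ *: _).
rewrite sE in bh.
exact: small_step_uniq (small_step_lift lf bz bh) (hc h hd _).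
Unshelve. all: by end_near.
Qed.

(** A local lift minus q a has vanishing partial derivatives on each slice; join
    the two points by a segment parallel to the reals followed by one parallel
    to I, both inside the ball. *)
Lemma local_lift_affine a : (forall q0 f I z, local_lift q0 f ->
    imag_units I -> ball q0 d (slice_point I z) ->
    is_derive z ((1, 0) : R * R) (f \o slice_point I) a /\
    is_derive z ((0, 1) : R * R) (f \o slice_point I) (I * a)) ->
  forall f I z0 z1, local_lift (slice_point I z0) f -> imag_units I ->
    `|slice_point I (z1 - z0)| < d ->
    f (slice_point I z1) - f (slice_point I z0) = slice_point I (z1 - z0) * a.
Proof.
move=> slope f I z0 z1 lf uI hd.
pose E (z : R * R) : quat R := f (slice_point I z) - (z.1 *: a + z.2 *: (I * a) + 0).
have dE z : ball (slice_point I z0) d (slice_point I z) ->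
    is_derive z ((1, 0) : R * R) E 0 /\ is_derive z ((0, 1) : R * R) E 0.
  move=> bz; have [dx dy] := slope _ _ _ _ lf uI bz.
  have ax := is_derive_affine a (I * a) 0 z (1, 0).
  have ay := is_derive_affine a (I * a) 0 z (0, 1).
  rewrite /= scale1r scale0r addr0 in ax; rewrite /= scale1r scale0r add0r in ay.
  split.
    by rewrite -(subrr a); exact: (is_deriveB dx ax).
  by rewrite -(subrr (I * a)); exact: (is_deriveB dy ay).
have inball (y : R * R) : `|y.1 - z0.1| <= `|z1.1 - z0.1| ->
    `|y.2 - z0.2| <= `|z1.2 - z0.2| -> ball (slice_point I z0) d (slice_point I y).
  move=> h1 h2; apply/qballP; apply: le_lt_trans hd.
  have -> : slice_point I y - slice_point I z0 = slice_point I (y - z0).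
    by apply/eqP; rewrite subr_eq -slice_pointD subrK.
  exact: slice_point_norm.
suff EE : E z1 = E z0.
  have sE z : slice_point I z * a = z.1 *: a + z.2 *: (I * a) + 0.
    by rewrite /slice_point mulrDl -!scaleqAl mul1r addr0.
  have -> : slice_point I (z1 - z0) = slice_point I z1 - slice_point I z0.
    by apply/eqP; rewrite eq_sym subr_eq -slice_pointD subrK.
  rewrite mulrBl !sE; move: EE; rewrite /E.
  set A1 := _ + 0; set A0 := _ + 0 => EE.
  by rewrite -[f (slice_point I z1)](subrK A1) EE addrAC [_ - A0]addrC addrK addrC.
apply/eqP; rewrite -subr_eq0 -qdot_eq0; apply/eqP.
set w := E z1 - E z0.
have e : qdot (E z1) w = qdot (E z0) w.
  transitivity (qdot (E (z1.1, z0.2)) w).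
    have dy s : `|s - z0.2| <= `|z1.2 - z0.2| ->
        is_derive s (1 : R) (fun s => qdot (E (z1.1, s)) w) 0.
      move=> hs; apply: (partial_snd (u := fun z => qdot (E z) w)).
      have [_ h] := dE _ (inball (z1.1, s) (lexx _) hs).
      by rewrite -[X in is_derive _ _ _ X](qdot0l w); exact: is_derive_qdot.
    have [c _ /eqP] := mean_value dy.
    by rewrite mul0r subr_eq0 -surjective_pairing => /eqP.
  have dx s : `|s - z0.1| <= `|z1.1 - z0.1| ->
      is_derive s (1 : R) (fun s => qdot (E (s, z0.2)) w) 0.
    move=> hs; apply: (partial_fst (u := fun z => qdot (E z) w)).
    have h0 : `|z0.2 - z0.2| <= `|z1.2 - z0.2| by rewrite subrr normr0.
    have [h _] := dE _ (inball (s, z0.2) hs h0).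
    by rewrite -[X in is_derive _ _ _ X](qdot0l w); exact: is_derive_qdot.
  have [c _ /eqP] := mean_value dx.
  by rewrite mul0r subr_eq0 -surjective_pairing => /eqP.
have -> : qdot w w = qdot (E z1) w - qdot (E z0) w.
  by rewrite {1}/w qdotBl.
by rewrite e subrr.
Qed.

End SmallSteps.

(** * Injective regular maps of tori *)

Section RegularMaps.
Variable R : realType.
Implicit Types (p q w x a b I : quat R).

Variables (L1 L2 : lattice R) (F : torus L1 -> torus L2).
Hypothesis rF : regular_map F.

(** Along a ray from the origin, which stays in one slice, the increments of
    local lifts add up to q a. *)
Lemma regular_map_affine : exists a, forall b, Defs.proj L2 b = F (Defs.proj L1 0) ->
  forall q, F (Defs.proj L1 q) = Defs.proj L2 (b + q * a).
Proof.
have [rho rho0 gap] := lattice_gap L2.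
have [d d0 lifts] := local_lifts rF (divr_gt0 rho0 (ltr0Sn _ 1)).
have [a slope] := small_step_slope d0 gap lifts.
exists a => b b0 q; have [I uI [z zq]] := slice_cover q.
have [N hN] : exists N : nat, `|q| / d < N.+1%:R.
  exists (Num.truncn (`|q| / d)); exact: truncnS_gt.
pose r k : R := k%:R / N.+1%:R.
have sZ (t : R) : slice_point I (t *: z) = t *: q.
  rewrite -zq /slice_point scalerDr !scalerA.
  by congr (_ *: _ + _ *: _).
have N0 : 0 < N.+1%:R :> R by rewrite ltr0n.
suff step k : F (Defs.proj L1 (r k *: q)) = Defs.proj L2 (b + (r k *: q) * a).
  by have := step N.+1; rewrite /r divff ?gt_eqF // scale1r.
elim: k => [|k ih]; first by rewrite /r mul0r scale0r mul0r addr0 b0.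
have [f lf] := lifts (slice_point I (r k *: z)).
have zd : r k.+1 *: z - r k *: z = N.+1%:R^-1 *: z.
  by rewrite -scalerBl /r -mulrBl -natrB // subSnn mul1r.
have qd : `|N.+1%:R^-1 *: q| < d.
  rewrite normrZ ger0_norm ?invr_ge0 ?ltW // mulrC ltr_pdivrMr //.
  by rewrite mulrC -ltr_pdivrMr.
have lt_d : `|slice_point I (r k.+1 *: z - r k *: z)| < d by rewrite zd sZ.
have fE := local_lift_affine slope lf uI lt_d.
have [_ pf _] := lf.
rewrite zd !sZ in fE; rewrite !sZ in pf.
have bk : ball (r k *: q) d (r k *: q) by exact: ballxx.
have bk1 : ball (r k *: q) d (r k.+1 *: q).
  apply/qballP; rewrite -scalerBl /r -mulrBl -natrB // subSnn mul1r //.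
rewrite -pf //; apply/proj_eq.
have /proj_eq : Defs.proj L2 (f (r k *: q)) = Defs.proj L2 (b + (r k *: q) * a).
  by rewrite pf.
congr (lattice_set L2 _).
have -> : f (r k.+1 *: q) = f (r k *: q) + (N.+1%:R^-1 *: q) * a.
  by rewrite -fE addrC subrK.
have -> : r k.+1 *: q = r k *: q + N.+1%:R^-1 *: q.
  by rewrite -scalerDl /r -addn1 natrD mulrDl mul1r.
rewrite mulrDl; set u := f _; set v := (r k *: q) * a; set t := _ * a.
by rewrite [b + (v + t)]addrA [- (b + v + t)]opprD addrACA subrr addr0.
Qed.

Lemma regular_injective_mulr : injective F -> exists2 a, a != 0 &
  forall x, lattice_set L1 x <-> lattice_set L2 (x * a).
Proof.
move=> iF; have [a aE] := regular_map_affine.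
have [b b0] := proj_surj (F (Defs.proj L1 0)).
have FE := aE b b0.
have xP x : lattice_set L1 x <-> lattice_set L2 (x * a).
  have e1 : lattice_set L1 x <-> F (Defs.proj L1 x) = F (Defs.proj L1 0).
    split=> [Lx|/iF/proj_eq]; last by rewrite subr0.
    by congr F; apply/proj_eq; rewrite subr0.
  rewrite e1 FE FE mul0r addr0; split=> [/proj_eq|Lx]; first by rewrite addrC addKr.
  exact: projD.
exists a => //; apply/eqP => a0.
have [rho rho0 gap] := lattice_gap L1.
have h x : lattice_set L1 x by apply/xP; rewrite a0 mulr0; exact: lattice0.
have := gap _ (h ((rho / 2) *: (1 : quat R))).
rewrite normrZ norm_quat1 mulr1 ger0_norm ?divr_ge0 ?ltW //.
rewrite ltr_pdivrMr // ltr_pMr // ltr1n => /(_ isT)/eqP.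
by rewrite scaler_eq0 oner_eq0 orbF gt_eqF // divr_gt0.
Qed.

End RegularMaps.

(** * Automorphism groups and moduli *)

Section Automorphisms.
Variable R : realType.
Implicit Types (p q w x a b I J l : quat R) (L : lattice R).

Lemma AutP L (F : quat R -> quat R) : Aut L F <-> exists b, [/\ S3 b,
  F = (fun q => q * b), forall x, lattice_set L x -> lattice_set L (x * b) &
  forall x, lattice_set L x -> lattice_set L (x * b^-1)].
Proof.
split=> [[b sb [-> LE]]|[b [sb -> h1 h2]]].
  have ub : b \is a GRing.unit by rewrite quat_unitE S3_neq0.
  exists b; split=> // x Lx; first by rewrite -LE; exists x.
  by move: Lx; rewrite -{1}LE => -[y Ly <-]; rewrite mulrK.
have ub : b \is a GRing.unit by rewrite quat_unitE S3_neq0.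
exists b => //; split=> //; apply/seteqP; split=> [_ [x Lx <-]|x Lx]; first exact: h1.
by exists (x * b^-1); [exact: h2|rewrite divrK].
Qed.

Lemma Aut_id L : Aut L id.
Proof.
apply/AutP; exists 1; split.
- by apply/S3P; exact: qdot1.
- by apply/funext => q; rewrite mulr1.
- by move=> x; rewrite mulr1.
- by move=> x; rewrite invr1 mulr1.
Qed.

Lemma Aut_comp L (F G : quat R -> quat R) : Aut L F -> Aut L G -> Aut L (F \o G).
Proof.
move=> [b sb [FE LF]] [c sc [GE LG]].
exists (c * b); first by apply/S3P; rewrite qdot_mul !(S3P _).1 // mulr1.
split; first by apply/funext => q; rewrite FE GE /= mulrA.
by rewrite -image_comp LG LF.
Qed.

Lemma qdot_conj l p q : l != 0 ->
  qdot (l * p * l^-1) (l * q * l^-1) = qdot p q.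
Proof.
move=> l0.
have e1 x y z : qdot (x * z) (y * z) = qdot x y * qdot z z.
  by rewrite !qdotE !quatE; ring.
have e2 x y z : qdot (z * x) (z * y) = qdot z z * qdot x y.
  by rewrite !qdotE !quatE; ring.
by rewrite e1 e2 qdotV mulrC mulrA mulVf ?mul1r // qdot_eq0.
Qed.

Lemma conj_mul l p q : l != 0 ->
  l * p * l^-1 * (l * q * l^-1) = l * (p * q) * l^-1.
Proof.
move=> l0; have : l^-1 * l = 1 by rewrite mulVr.
move: (l^-1) => m ml.
by rewrite -mulrA (mulrA m) (mulrA m) ml mul1r !mulrA.
Qed.

Lemma conjV a b : a != 0 -> b != 0 -> (a^-1 * b * a)^-1 = a^-1 * b^-1 * a.
Proof.
move=> a0 b0; have ua : a \is a GRing.unit by rewrite quat_unitE.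
have ub : b \is a GRing.unit by rewrite quat_unitE.
have uab : a^-1 * b \is a GRing.unit by rewrite quat_unitE qmul_eq0 invr_eq0 (negbTE a0).
rewrite (invrM uab ua) (invrM _ ub) ?unitrV //.
by rewrite invrK mulrA.
Qed.

Lemma frame_conj l I J h : l != 0 ->
  frame (l * I * l^-1) (l * J * l^-1) h = l * frame I J h * l^-1.
Proof.
move=> l0; rewrite /frame conj_mul //.
have : l * l^-1 = 1 by rewrite divrr.
move: (l^-1) => m lm.
have sc (c : R) x : l * (c *: x) * m = c *: (l * x * m).
  by rewrite -(scaleqAr c l x) -(scaleqAl c (l * x) m).
by rewrite 3!mulrDr 3!mulrDl 4!sc mulr1 lm.
Qed.

Lemma omega_cube I J : imag_units I -> imag_units J -> qdot I J = 0 ->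
  omega I J * omega I J * omega I J = 1.
Proof.
move=> uI uJ oIJ; rewrite omega_frame -!frameM // -[RHS](frame1 I J).
have -> : qw R * qw R = mkquat (- 2^-1) (- 2^-1) (- 2^-1) (- 2^-1).
  by apply: quatP; rewrite !quatE; field.
by congr frame; apply: quatP; rewrite !quatE; field.
Qed.

Lemma omega_neq1 I J : imag_units I -> imag_units J -> qdot I J = 0 -> omega I J <> 1.
Proof.
move=> uI uJ oIJ; rewrite omega_frame -(frame1 I J) => /(frame_inj uI uJ oIJ).
by move=> /(congr1 (fun x : quat R => x 0 0)); rewrite !quatE; lra.
Qed.

Lemma omegaI_cube I J : imag_units I -> imag_units J -> qdot I J = 0 ->
  omega I J * I * (omega I J * I) * (omega I J * I) = 1.
Proof.
move=> uI uJ oIJ.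
have -> : omega I J * I = frame I J (mkquat (- 2^-1) (- 2^-1) 2^-1 (- 2^-1)).
  have {2}<- : frame I J (qi R) = I by rewrite /qi frame_i.
  rewrite omega_frame -frameM //.
  by congr frame; apply: quatP; rewrite !quatE; field.
rewrite -!frameM // -[RHS](frame1 I J); congr frame.
rewrite [mkquat _ _ _ _ * mkquat _ _ _ _](_ : _ =
  mkquat (- 2^-1) 2^-1 (- 2^-1) 2^-1); last by apply: quatP; rewrite !quatE; field.
by apply: quatP; rewrite !quatE; field.
Qed.

Lemma omegaI_neq1 I J : imag_units I -> imag_units J -> qdot I J = 0 ->
  omega I J * I <> 1.
Proof.
move=> uI uJ oIJ.
have {2}<- : frame I J (qi R) = I by rewrite /qi frame_i.
rewrite omega_frame -frameM // -(frame1 I J) => /(frame_inj uI uJ oIJ).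
by move=> /(congr1 (fun x : quat R => x 0 0)); rewrite !quatE; lra.
Qed.

Lemma quat1_neq_opp1 : (1 : quat R) <> -1.
Proof. by move=> /(congr1 (fun x : quat R => x 0 0)); rewrite !quatE; lra. Qed.

(** An isomorphism transports the orders of I0, omega0 and omega0 I0 to the
    multipliers of two automorphisms; these orders alone exhibit a frame whose
    Hurwitz order acts on the lattice. *)
Lemma tetrahedral_modulus L I0 J0 :
  imag_units I0 -> imag_units J0 -> qdot I0 J0 = 0 ->
  group_isomorphic (Aut L) (fun F G => F \o G)
    (binary_tetrahedral I0 J0) (fun p q => p * q) ->
  exists I J, [/\ imag_units I, imag_units J, qdot I J = 0 &
    is_modulus L (- omega I J, - I, I * omega I J)].
Proof.
move=> uI0 uJ0 oIJ0 [phi [[phiT phi_inj phi_surj] phiM]].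
have phi_id : phi id = 1.
  have := phiM id id (mem_set (Aut_id L)) (mem_set (Aut_id L)).
  have := phiT _ (Aut_id L); rewrite binary_tetrahedralE // => -[h [_ nh] hE].
  have u : phi id \is a GRing.unit.
    by rewrite quat_unitE -hE frame_eq0 // -qdot_eq0 nh oner_eq0.
  by move=> /(congr1 (fun x => (phi id)^-1 * x)); rewrite mulVr // mulKr.
have inj F G : Aut L F -> Aut L G -> phi F = phi G -> F = G.
  by move=> AF AG; apply: phi_inj; rewrite inE.
have mor F G : Aut L F -> Aut L G -> phi (F \o G) = phi F * phi G.
  by move=> AF AG; apply: phiM; rewrite inE.
have [F AF FE] : exists2 F, Aut L F & phi F = I0.
  by have [|F AF FE] := phi_surj I0; [apply: sub_gen_smallest; left|exists F].
have [G AG GE] : exists2 G, Aut L G & phi G = omega I0 J0.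
  by have [|G AG GE] := phi_surj (omega I0 J0); [apply: sub_gen_smallest; right|exists G].
have [a [sa Fa La La']] := (AutP L F).1 AF.
have [b [sb Gb Lb Lb']] := (AutP L G).1 AG.
have AFF := Aut_comp AF AF; have AGG := Aut_comp AG AG.
have AGF := Aut_comp AG AF.
have aa : a * a = -1.
  have e4 : (a * a) * (a * a) = 1.
    have e : (F \o F) \o (F \o F) = id.
      apply: inj; [exact: Aut_comp|exact: Aut_id|].
      have II : I0 * I0 = -1 by rewrite -expr2.
      by rewrite (mor _ _ AFF AFF) (mor _ _ AF AF) FE phi_id II mulrNN mulr1.
    by have := congr1 (fun f => f 1) e; rewrite /= Fa mul1r !mulrA.
  have [e|//] := sqr_quat_eq1 e4.
  case: quat1_neq_opp1; rewrite -uI0 expr2 -FE -(mor _ _ AF AF) -phi_id.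
  by congr phi; apply/funext => q; rewrite Fa /= -mulrA e mulr1.
have b3 : b * b * b = 1.
  have e : (G \o G) \o G = id.
    apply: inj; [exact: Aut_comp|exact: Aut_id|].
    by rewrite (mor _ _ AGG AG) (mor _ _ AG AG) GE phi_id omega_cube.
  by have := congr1 (fun f => f 1) e; rewrite /= Gb mul1r.
have b1 : b <> 1.
  move=> e; case: (omega_neq1 uI0 uJ0 oIJ0); rewrite -GE -phi_id.
  by congr phi; apply/funext => q; rewrite Gb e mulr1.
have c3 : a * b * (a * b) * (a * b) = 1.
  have e : ((G \o F) \o (G \o F)) \o (G \o F) = id.
    apply: inj; [by do 2?apply: Aut_comp|exact: Aut_id|].
    by rewrite (mor _ _ (Aut_comp AGF AGF) AGF) (mor _ _ AGF AGF) (mor _ _ AG AF) GE FE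
         phi_id omegaI_cube.
  by have := congr1 (fun f => f 1) e; rewrite /= Gb Fa mul1r !mulrA.
have c1 : a * b <> 1.
  move=> e; case: (omegaI_neq1 uI0 uJ0 oIJ0); rewrite -GE -FE -(mor _ _ AG AF) -phi_id.
  by congr phi; apply/funext => q; rewrite Gb Fa /= -mulrA e mulr1.
have [J [uJ oaJ] wE] := omega_recover aa b3 b1 c3 c1.
have ua : imag_units a by rewrite /imag_units /= expr2.
have Lw x : lattice_set L x -> lattice_set L (x * omega a J) by rewrite wE; exact: Lb.
have [l l0 LE] := lattice_hurwitz_principal ua uJ oaJ La Lw.
pose I' := l * a * l^-1; pose J' := l * J * l^-1.
have cu q : imag_units q -> imag_units (l * q * l^-1).
  rewrite /imag_units /= !expr2 conj_mul // => ->.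
  by rewrite mulrN1 mulNr divrr ?quat_unitE.
have uI' := cu _ ua; have uJ' := cu _ uJ.
have o' : qdot I' J' = 0 by rewrite qdot_conj.
exists I', J'; split => //; split; first exact: (hurwitz_basis_special uI' uJ' o').
have LP : exists2 v : 4.-tuple (quat R), free v &
    Zspan (hurwitz_basis I' J') = Zspan v.
  by exists (hurwitz_basis I' J') => //; exact: hurwitz_basis_free.
exists (Lattice LP) => //.
apply: (@mulr_equivalent _ _ _ l^-1); first by rewrite invr_eq0.
move=> x; rewrite LE /= Zspan_hurwitz //; split=> [[h hh ->]|[h hh]].
  by exists h => //; rewrite frame_conj.
rewrite frame_conj // => /(congr1 (fun y => y * l)).
by rewrite !divrK ?quat_unitE // => <-; exists h.
Qed.

(** If L a is the Hurwitz order of the frame I, J, then conjugation by a carries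
    the multipliers of the automorphisms to its units; inversion turns the
    resulting antihomomorphism into a homomorphism. *)
Lemma modulus_tetrahedral L I0 J0 I J :
  imag_units I0 -> imag_units J0 -> qdot I0 J0 = 0 ->
  imag_units I -> imag_units J -> qdot I J = 0 ->
  is_modulus L (- omega I J, - I, I * omega I J) ->
  group_isomorphic (Aut L) (fun F G => F \o G)
    (binary_tetrahedral I0 J0) (fun p q => p * q).
Proof.
move=> uI0 uJ0 oIJ0 uI uJ oIJ [_ [L' LE' [F [rF [G [FK _ _]]]]]].
have [a a0 La] := regular_injective_mulr rF (can_inj FK).
have ua : a \is a GRing.unit by rewrite quat_unitE.
have L'P x : lattice_set L' x <-> (exists2 h, hurwitz h & frame I J h = x).
  by rewrite LE' -/(hurwitz_basis I J) Zspan_hurwitz.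
have [psi psiK] := choice (frame_surj uI uJ oIJ).
have finj := frame_inj uI uJ oIJ.
have psiM p q : psi (p * q) = psi p * psi q.
  by apply: finj; rewrite frameM // !psiK.
have psiV p : psi p^-1 = (psi p)^-1 by apply: finj; rewrite frameV // !psiK.
pose phi (F : quat R -> quat R) := frame I0 J0 (psi (a^-1 * (F 1)^-1 * a)).
exists phi; split; last first.
  move=> f g /[!inE] /AutP[b [sb fb _ _]] /AutP[c [sc gc _ _]].
  have ub : b \is a GRing.unit by rewrite quat_unitE S3_neq0.
  have uc : c \is a GRing.unit by rewrite quat_unitE S3_neq0.
  rewrite /phi fb gc /= !mul1r invrM // -frameM // -psiM.
  by congr (frame _ _ (psi _)); rewrite !mulrA mulrK.
rewrite binary_tetrahedralE //; split.
- move=> f /AutP[b [sb fb Lb _]].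
  have ub : b \is a GRing.unit by rewrite quat_unitE S3_neq0.
  exists (psi (a^-1 * (f 1)^-1 * a)) => //.
  have -> : a^-1 * (f 1)^-1 * a = (a^-1 * b * a)^-1.
    by rewrite fb mul1r conjV // S3_neq0.
  rewrite psiV; apply: hurwitz_unitV; split.
    have /L'P[h hh] : lattice_set L' (a^-1 * b * a).
      apply/La/Lb/La; rewrite mulVr //; apply/L'P.
      by exists 1; [exact: hurwitz1|rewrite frame1].
    by rewrite -{1}(psiK (a^-1 * b * a)) => /finj <-.
  rewrite -(qdot_frame uI uJ oIJ) psiK !qdot_mul qdotV mulrAC mulVf ?qdot_eq0 //.
  by rewrite mul1r; apply/S3P.
- move=> f g /[!inE] /AutP[b [sb fb _ _]] /AutP[c [sc gc _ _]].
  rewrite /phi fb gc !mul1r => /(frame_inj uI0 uJ0 oIJ0) /(congr1 (frame I J)).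
  rewrite !psiK => /(mulIr ua) /mulrI => /(_ _)/invr_inj bc.
  by rewrite bc // unitrV.
- move=> _ [h hu <-].
  have hu' := hurwitz_unitV hu.
  have h0 : h != 0 by apply: S3_neq0; apply/S3P; case: hu.
  have fu : frame I J h \is a GRing.unit by rewrite quat_unitE frame_eq0.
  have bV : (a * frame I J h^-1 * a^-1)^-1 = a * frame I J h * a^-1.
    have a0' : a^-1 != 0 by rewrite invr_eq0.
    rewrite frameV // -[X in X * _ * _](invrK a) conjV ?invrK //.
    by rewrite invr_eq0 frame_eq0.
  have Lmul k x : hurwitz k -> lattice_set L x ->
      lattice_set L (x * (a * frame I J k * a^-1)).
    move=> hk /La/L'P[m hm me]; apply/La; rewrite !mulrA divrK // -me.
    by apply/L'P; exists (m * k); [exact: hurwitzM|rewrite frameM].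
  exists (fun q => q * (a * frame I J h^-1 * a^-1)).
    apply/AutP; exists (a * frame I J h^-1 * a^-1); split=> //.
    + by apply/S3P; rewrite qdot_conj // qdot_frame //; case: hu'.
    + by move=> x; apply: Lmul; case: hu'.
    + by move=> x; rewrite bV; apply: Lmul; case: hu.
  rewrite /phi mul1r bV !mulrA mulVr // mul1r -mulrA mulVr // mulr1.
  by congr frame; apply: finj; rewrite psiK.
Qed.

End Automorphisms.

Theorem proposition8p20 (R : realType) (L : lattice R)
    (I0 J0 : quat R) (hI0 : imag_units I0) (hJ0 : imag_units J0)
    (hIJ0 : qdot I0 J0 = 0) :
  group_isomorphic (Aut L) (fun F G => F \o G)
    (binary_tetrahedral I0 J0) (fun p q => p * q) <->
  exists I J : quat R, [/\ imag_units I, imag_units J, qdot I J = 0 &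
    is_modulus L (- omega I J, - I, I * omega I J)].
Proof.
split; first exact: tetrahedral_modulus.
move=> [I [J [uI uJ oIJ hm]]].
exact: (modulus_tetrahedral hI0 hJ0 hIJ0 uI uJ oIJ hm).
Qed.
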